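(* Let $q\ge 2$ be an integer for which there exists an affine plane of order $q$. There exists an integer $N=N(q)$ such that, for every $n\ge N$, there is a graph $TLS(q,n)$ with the following properties: (i) $TLS(q,n)$ is cospectral with the $2$-clique extension of a Latin square graph $LS_{q+1}(n)$. Its spectrum (exponents denoting multiplicities) is \[ \{[2(q+1)(n-1)+1]^1,\ [2n-2q-1]^{(n-1)(q+1)},\ [-2q-1]^{(n-1)(n-q)},\ [-1]^{n^2}\}. \] In particular, it has exactly four distinct eigenvalues and smallest eigenvalue $-2q-1$. (ii) $TLS(q,n)$ is co-edge-regular with parameter $\mu=2q(q+1)$. (iii) $\Lambda(TLS(q,n))\ge q+2$ and $\operatorname{cr}(TLS(q,n))\ge q+4$.
   Context: Graphs are finite, simple and undirected; spectra are those of adjacency matrices, and two graphs are cospectral if their adjacency matrices have the same spectrum (with multiplicities). For adjacent vertices $x,y$ of $G$ put $\lambda_G(x,y)=|N_G(x)\cap N_G(y)|$; the $\lambda$-level of $G$ is $\Lambda(G)=\#\{\lambda_G(x,y):x\sim y\}$. A graph is sesqui-regular with parameters $(v,k,\mu)$ if it has $v$ vertices, is $k$-regular, and every two vertices at distance two have exactly $\mu$ common neighbours. It is co-edge-regular with parameters $(v,k,\mu)$ (co-edge-regular with parameter $\mu$) if it is sesqui-regular with parameters $(v,k,\mu)$ and has diameter two. The coherent closure $W(G)$ of $G$ with adjacency matrix $A$ is the smallest matrix algebra over $\mathbb C$ containing $I,J,A$ ($J$ the all-ones matrix) closed under transposition and entrywise multiplication; $\operatorname{cr}(G)=\dim W(G)$.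 The $t$-clique extension $G^{[t]}$ is obtained from $G$ by replacing each vertex $x$ by a clique $X$ of order $t$, and joining $X$ completely to $Y$ whenever $x\sim y$ in $G$. A partial linear space is a pair $(P,\mathcal L)$, $P$ a non-empty finite set of points, $\mathcal L$ a set of subsets of $P$ (lines), such that every line has at least two points and every two distinct points lie on at most one line. It is $(s,t)$-regular if every point is on $s+1$ lines and every line has $t+1$ points. Its point graph has vertex set $P$, two distinct points being adjacent iff they lie on a common line. An affine plane of order $q$ is a $(q,q-1)$-regular partial linear space in which for every point $p$ and line $L$ with $p\notin L$ there is a unique line through $p$ disjoint from $L$. A net $\mathcal N(q+1,n)$ of order $n$ and degree $q+1$ is a $(q,n-1)$-regular partial linear space in which for every point $p$ and every line $L$ with $p\notin L$ there is a unique line through $p$ disjoint from $L$. A Latin square graph $LS_{q+1}(n)$ is the point graph of a net $\mathcal N(q+1,n)$; it has $n^2$ vertices and spectrum $\{[(n-1)(q+1)]^1,[n-q-1]^{(n-1)(q+1)},[-q-1]^{(n-1)(n-q)}\}$. *)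

(* Defs.v *)
From HB Require Import structures.
From mathcomp Require Import all_boot all_order all_algebra.
From mathcomp Require Import boolp reals.
From mathcomp Require Import complex.

Set Implicit Arguments.
Unset Strict Implicit.
Unset Printing Implicit Defensive.

Import Order.TTheory GRing.Theory Num.Theory.

Local Open Scope ring_scope.

Record sgraph := SGraph {
  vertex :> finType;
  adj : rel vertex;
  adj_sym : symmetric adj;
  adj_irr : irreflexive adj }.

Definition nbhd (G : sgraph) (x : G) : {set G} := [set y | adj x y].

Definition common_nbrs (G : sgraph) (x y : G) : nat := #|nbhd x :&: nbhd y|.

(* The number of distinct values of [common_nbrs] on adjacent pairs. *)
Definition lambda_level (G : sgraph) : nat :=
  size (undup [seq common_nbrs p.1 p.2 | p : G * G in [pred p | adj p.1 p.2]]).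

(* [has_dist x y d]: some walk from [x] to [y] has length [d] and none is
   shorter; no [d] qualifies if [x] and [y] are in different components. *)
Definition has_dist (G : sgraph) (x y : G) (d : nat) : Prop :=
  (exists p : seq G, [/\ path (@adj G) x p, last x p = y & size p = d]) /\
  (forall p : seq G, path (@adj G) x p -> last x p = y -> (d <= size p)%N).

Definition has_diameter (G : sgraph) (d : nat) : Prop :=
  (forall x y : G, exists2 k : nat, (k <= d)%N & has_dist x y k) /\
  (exists x y : G, has_dist x y d).

Definition regular_graph (G : sgraph) (k : nat) : Prop :=
  forall x : G, #|nbhd x| = k.

Definition sesqui_regular (G : sgraph) (v k mu : nat) : Prop :=
  [/\ #|G| = v, regular_graph G k &
      forall x y : G, has_dist x y 2 -> common_nbrs x y = mu].

Definition coedge_regular (G : sgraph) (v k mu : nat) : Prop :=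
  sesqui_regular G v k mu /\ has_diameter G 2.

Definition adjmx (F : nzRingType) (G : sgraph) : 'M[F]_#|G| :=
  \matrix_(i, j) (adj (enum_val i) (enum_val j))%:R.

(* The roots of the characteristic polynomial, listed with multiplicity in an
   unspecified order: as a multiset it is only meaningful up to [perm_eq]. *)
Definition spectrum (F : closedFieldType) (n : nat) (M : 'M[F]_n) : seq F :=
  sval (closed_field_poly_normal (char_poly M)).

Lemma char_poly_spectrum (F : closedFieldType) (n : nat) (M : 'M[F]_n) :
  char_poly M = \prod_(a <- spectrum M) ('X - a%:P).
Proof.
rewrite /spectrum; case: closed_field_poly_normal => s /= {1}->.
by rewrite (monicP (char_poly_monic M)) scale1r.
Qed.

Definition cospectral (F : closedFieldType) (G H : sgraph) : bool :=
  perm_eq (spectrum (adjmx F G)) (spectrum (adjmx F H)).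

Definition coherent_algebra (F : fieldType) (G : sgraph)
    (W : {vspace 'M[F]_#|G|}) : Prop :=
  [/\ 1%:M \in W, const_mx 1 \in W & adjmx F G \in W] /\
  [/\ {in W &, forall M N, M *m N \in W},
      {in W, forall M, M^T \in W} &
      {in W &, forall M N, map2_mx *%R M N \in W}].

Lemma coherent_closure_exists (F : fieldType) (G : sgraph) :
  exists W : {vspace 'M[F]_#|G|}, coherent_algebra W /\
    forall U : {vspace 'M[F]_#|G|}, coherent_algebra U -> (W <= U)%VS.
Proof.
pose P d := `[< exists2 W : {vspace 'M[F]_#|G|}, coherent_algebra W & \dim W = d >].
have exP : exists d, P d.
  exists (\dim {:'M[F]_#|G|}); apply/asboolP; exists fullv => //.
  have inT M : M \in {:'M[F]_#|G|}%VS by exact: memvf.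
  by do 2 split; move=> *; exact: inT.
case: (ex_minnP exP) => d /asboolP[W cW <-] minW; exists W; split=> // U cU.
suff cI : coherent_algebra (W :&: U)%VS.
  have le_dim : (\dim W <= \dim (W :&: U))%N.
    by apply: minW; apply/asboolP; exists (W :&: U)%VS.
  have /eqP <- : (W :&: U == W)%VS by rewrite eqEdim capvSl.
  exact: capvSr.
case: cW cU => [[W1 WJ WA] [WM WT WH]] [[U1 UJ UA] [UM UT UH]].
split; split; rewrite ?memv_cap ?W1 ?WJ ?WA //.
- move=> M N; rewrite !memv_cap => /andP[? ?] /andP[? ?].
  by rewrite WM ?UM.
- by move=> M; rewrite !memv_cap => /andP[? ?]; rewrite WT ?UT.
- move=> M N; rewrite !memv_cap => /andP[? ?] /andP[? ?].
  by rewrite WH ?UH.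
Qed.

Definition coherent_closure (F : fieldType) (G : sgraph) :
    {vspace 'M[F]_#|G|} := sval (cid (coherent_closure_exists F G)).

Lemma coherent_closureP (F : fieldType) (G : sgraph) :
  coherent_algebra (coherent_closure F G) /\
  forall U : {vspace 'M[F]_#|G|},
    coherent_algebra U -> (coherent_closure F G <= U)%VS.
Proof. exact: svalP (cid (coherent_closure_exists F G)). Qed.

Definition coherent_rank (F : fieldType) (G : sgraph) : nat :=
  \dim (coherent_closure F G).

Section CliqueExtension.
Variables (t : nat) (G : sgraph).

Definition clique_ext_adj : rel (G * 'I_t) := fun a b =>
  (a.1 == b.1) && (a.2 != b.2) || adj a.1 b.1.

Lemma clique_ext_sym : symmetric clique_ext_adj.
Proof.
by move=> a b; rewrite /clique_ext_adj adj_sym [a.1 == _]eq_sym [a.2 == _]eq_sym.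
Qed.

Lemma clique_ext_irr : irreflexive clique_ext_adj.
Proof. by move=> a; rewrite /clique_ext_adj !eqxx adj_irr. Qed.

Definition clique_ext : sgraph := SGraph clique_ext_sym clique_ext_irr.

End CliqueExtension.

Definition partial_linear_space (P : finType) (Ls : {set {set P}}) : Prop :=
  [/\ (0 < #|P|)%N,
      {in Ls, forall L : {set P}, (2 <= #|L|)%N} &
      forall x y : P, x != y ->
        (#|[set L in Ls | (x \in L) && (y \in L)]| <= 1)%N].

Definition regular_pls (s t : nat) (P : finType) (Ls : {set {set P}}) : Prop :=
  [/\ partial_linear_space Ls,
      forall x : P, #|[set L in Ls | x \in L]| = s.+1 &
      {in Ls, forall L : {set P}, #|L| = t.+1}].

Definition parallel_axiom (P : finType) (Ls : {set {set P}}) : Prop :=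
  forall (p : P) (L : {set P}), L \in Ls -> p \notin L ->
    exists! M : {set P}, [/\ M \in Ls, p \in M & [disjoint M & L]].

Definition affine_plane (q : nat) (P : finType) (Ls : {set {set P}}) : Prop :=
  regular_pls q q.-1 Ls /\ parallel_axiom Ls.

(* A net of degree [k] and order [n]; both are meant to be positive. *)
Definition net (k n : nat) (P : finType) (Ls : {set {set P}}) : Prop :=
  regular_pls k.-1 n.-1 Ls /\ parallel_axiom Ls.

Section PointGraph.
Variables (P : finType) (Ls : {set {set P}}).

Definition collinear : rel P := fun x y =>
  (x != y) && [exists L in Ls, (x \in L) && (y \in L)].

Lemma collinear_sym : symmetric collinear.
Proof.
move=> x y; rewrite /collinear eq_sym; congr (_ && _).
by apply: eq_existsb => L; rewrite [(x \in L) && _]andbC.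
Qed.

Lemma collinear_irr : irreflexive collinear.
Proof. by move=> x; rewrite /collinear eqxx. Qed.

Definition point_graph : sgraph := SGraph collinear_sym collinear_irr.

End PointGraph.

(* Main.v *)
Require Import Defs.
From HB Require Import structures.
From mathcomp Require Import all_boot all_order all_algebra.
From mathcomp Require Import boolp reals.
From mathcomp Require Import complex.
From mathcomp Require Import cyclic finfield.
From mathcomp Require Import zify ring.

(** A net of degree q+1 and order n that contains an affine plane of order q as a
subnet S exists for all large n: Wilson's construction writes n = m t + u and
inflates a truncated transversal design of order t by designs of orders m and
m + 1; choosing m + 1 = q D with D highly divisible, the design of order m + 1 is a
direct product and contains the plane, while t and u can be chosen so that MacNeish's
bound applies to m, t and u.

In the 2-clique extension of the point graph, the 2 q^2 vertices over S form a
clique, and a vertex outside is joined to none of it or to both copies of one line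
of S. TLS(q,n) keeps these lines in the first copy of S but permutes the lines of
each parallel class in the second copy. The matrix with entries (h(x,y) - 1)/q,
h(x,y) being the number of permuted lines through x that carry y, is orthogonal,
so A + I = E X E^T with E^T E = 2 I and X = A_0 + I, A_0 the adjacency matrix of the
point graph, for TLS(q,n) as well as for the clique extension. This gives the
spectrum; squaring gives regularity, mu, and lambda = 2 (n - q) h + 2 q^2 - 2.
Rotating the first i lines of class i makes h take all values 0, ..., q + 1. *)

(** Call T the matrix with entries (h - 1)/q. When nothing is permuted, two points of S share 1 + q
    [x = y] lines and T is the identity. In general T sends the indicator of a line of S to that of
    a line of S in the same class, and its rows and columns sum to 1. Now X is all ones on S, and a
    point outside S sees S as nothing or as a single line, so multiplying X by T only renames lines
    and leaves a 0/1 matrix. E stacks the identity for the first copy on T, extended by the identity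
    outside S, for the second; hence E^T E = 2 I follows from T^T T = I.

    In the existence part the obstacle is that n may have small prime factors, where MacNeish's
    bound is too weak. Of m and m + 1 one is even, so they cannot both avoid small primes: m + 1 is
    made highly divisible, and then m is prime to all of them. The plane must moreover lie in the
    design of order m + 1 away from the block that Wilson's construction removes. *)

Set Implicit Arguments.
Unset Strict Implicit.
Unset Printing Implicit Defensive.
Import Order.TTheory GRing.Theory Num.Theory.

Local Open Scope ring_scope.

(** * Transversal designs *)

Section TransversalDesigns.
Local Open Scope nat_scope.

(** A transversal design with one group, a copy of [G], per index in [K]; a block is the function
    picking its point in each group, and blocks are compared pointwise. For finite types it amounts
    to [#|K| - 2] mutually orthogonal Latin squares of order [#|G|]. *)
Definition td (K : eqType) (G : Type) (B : (K -> G) -> Prop) : Prop :=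
  (forall i j a b, i != j -> exists f, [/\ B f, f i = a & f j = b]) /\
  (forall i j f g, i != j -> B f -> B g -> f i = g i -> f j = g j -> f =1 g).

(** The renaming may differ from group to group; this freedom later turns a chosen block into the
    constant block [None]. *)
Lemma td_rename (K : eqType) (G H : Type) (B : (K -> G) -> Prop)
    (phi : K -> G -> H) :
    (forall i, bijective (phi i)) -> td B ->
  td (fun f => exists2 g, B g & forall i, f i = phi i (g i)).
Proof.
move=> bij [exB uB]; split.
  move=> i j a b neq; case: (bij i) => p' _ pK; case: (bij j) => r' _ rK.
  have [f [Bf fi fj]] := exB i j (p' a) (r' b) neq.
  by exists (fun l => phi l (f l)); split; [exists f | rewrite fi pK | rewrite fj rK].
move=> i j f g neq [f' Bf' Ef] [g' Bg' Eg] fi fj l.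
rewrite Ef Eg; congr (phi l _); apply: (uB i j) => //.
  by apply: (bij_inj (bij i)); rewrite -Ef -Eg.
by apply: (bij_inj (bij j)); rewrite -Ef -Eg.
Qed.

Lemma td_sub (K : eqType) (L : eqType) (s : K -> L) (G : Type)
    (B : (L -> G) -> Prop) : injective s -> td B ->
  td (fun f => exists2 g, B g & forall i, f i = g (s i)).
Proof.
move=> s_inj [exB uB]; split.
  move=> i j a b neq.
  have [|f [Bf fi fj]] := exB (s i) (s j) a b; first by rewrite (inj_eq s_inj).
  by exists (fun l => f (s l)); split=> //; exists f.
move=> i j f g neq [f' Bf' Ef] [g' Bg' Eg] fi fj l.
rewrite Ef Eg; apply: (uB (s i) (s j)); rewrite ?(inj_eq s_inj) //.
  by rewrite -Ef -Eg.
by rewrite -Ef -Eg.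
Qed.

Lemma td_prod (K : eqType) (G H : Type) (B : (K -> G) -> Prop)
    (C : (K -> H) -> Prop) : td B -> td C ->
  td (fun f => exists g h, [/\ B g, C h & forall i, f i = (g i, h i)]).
Proof.
move=> [exB uB] [exC uC]; split.
  move=> i j [a a'] [b b'] neq.
  have [f [Bf fi fj]] := exB i j a b neq.
  have [g [Cg gi gj]] := exC i j a' b' neq.
  by exists (fun l => (f l, g l)); rewrite fi fj gi gj; split=> //; exists f, g.
move=> i j f f' neq [g [h [Bg Ch Ef]]] [g' [h' [Bg' Ch' Ef']]].
rewrite !Ef !Ef' => -[gi hi] [gj hj] l; rewrite Ef Ef'.
by rewrite (uB i j g g') // (uC i j h h').
Qed.

(** The blocks are the non-vertical lines over [F], read at the distinct abscissae [s i]. *)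
Lemma td_field (K : eqType) (F : fieldType) (s : K -> F) : injective s ->
  td (fun f : K -> F => exists a b, forall i, f i = (a * s i + b)%R).
Proof.
move=> s_inj; split.
  move=> i j a b neq; set d := (s j - s i)%R.
  have d0 : d != 0%R by rewrite subr_eq0 (inj_eq s_inj) eq_sym.
  exists (fun l => ((b - a) / d * s l + (a - (b - a) / d * s i))%R); split.
  - by exists ((b - a) / d)%R, (a - (b - a) / d * s i)%R.
  - by rewrite addrCA subrr addr0.
  - by rewrite addrCA -mulrBr -/d divfK // addrCA subrr addr0.
move=> i j f g neq [a [b Ef]] [a' [b' Eg]]; rewrite !Ef !Eg => e1 e2.
have : ((a - a') * (s i - s j) = 0)%R.
  have -> : ((a - a') * (s i - s j)
      = a * s i + b - (a' * s i + b') - (a * s j + b - (a' * s j + b')))%R by ring.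
  by rewrite e1 e2; ring.
move/eqP; rewrite mulf_eq0 !subr_eq0 (inj_eq s_inj) (negbTE neq) orbF => /eqP Ea.
move=> l; rewrite Ef Eg Ea; congr (_ + _)%R.
by move: e1; rewrite Ea => /addrI.
Qed.

Lemma card_bij (T U : finType) : #|T| = #|U| -> exists f : T -> U, bijective f.
Proof.
move=> eTU; exists (fun x => enum_val (cast_ord eTU (enum_rank x))).
exists (fun y => enum_val (cast_ord (esym eTU) (enum_rank y))) => x.
  by rewrite enum_valK cast_ordK enum_rankK.
by rewrite enum_valK cast_ordKV enum_rankK.
Qed.

Lemma card_bij_at (T U : finType) (x : T) (y : U) :
  #|T| = #|U| -> exists2 f : T -> U, bijective f & f x = y.
Proof.
case/card_bij=> f f_bij; case: (f_bij) => g fK gK.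
pose sw z := if z == x then g y else if z == g y then x else z.
have swK : involutive sw.
  move=> z; rewrite /sw; case: (eqVneq z x) => [->|zx].
    by rewrite eqxx; case: eqP.
  by case: (eqVneq z (g y)) => [->|zy]; rewrite ?eqxx // (negbTE zx) (negbTE zy).
exists (f \o sw); last by rewrite /sw /= eqxx gK.
by apply: bij_comp => //; exists sw.
Qed.

Definition has_td (K : eqType) (n : nat) : Prop :=
  exists B : (K -> 'I_n) -> Prop, td B.

Lemma has_td_card (K : eqType) (G : finType) (B : (K -> G) -> Prop) :
  td B -> has_td K #|G|.
Proof.
move=> tdB; have [|f f_bij] := @card_bij G 'I_#|G|; first by rewrite card_ord.
by eexists; apply: (td_rename (phi := fun _ => f)) tdB => _.
Qed.

Lemma has_td_mul (K : eqType) (m n : nat) :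
  has_td K m -> has_td K n -> has_td K (m * n).
Proof.
move=> [B tdB] [C tdC]; have := has_td_card (td_prod tdB tdC).
by rewrite card_prod !card_ord.
Qed.

Lemma has_td1 (K : eqType) : has_td K 1.
Proof.
exists (fun=> True); split; first by move=> i j a b _; exists (fun=> ord0); rewrite !ord1.
by move=> i j f g _ _ _ _ _ l; rewrite !ord1.
Qed.

Lemma has_td_prime_power (K : finType) (p e : nat) :
  prime p -> 0 < e -> #|K| <= p ^ e -> has_td K (p ^ e).
Proof.
move=> p_pr e_gt0 leK; have [F _ cardF] := pPrimePowerField p_pr e_gt0.
pose s (i : K) : F := enum_val (cast_ord (esym cardF) (widen_ord leK (enum_rank i))).
have s_inj : injective s.
  by move=> i j /enum_val_inj/cast_ord_inj/(congr1 val)/= /val_inj/enum_rank_inj.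
by rewrite -cardF; apply: has_td_card (td_field s_inj).
Qed.

(** Forces every prime power in the factorisation of [n] to be at least [k], in a form that
    congruences modulo k!^k can ensure. *)
Definition no_small_prime_power (k n : nat) : Prop :=
  forall p, prime p -> p <= k -> p %| n -> p ^ k %| n.

(** MacNeish's bound: split off the full power of the least prime factor, use a field of that order,
    and multiply. *)
Lemma has_td_no_small_prime_power (K : finType) (n : nat) :
  0 < n -> no_small_prime_power #|K| n -> has_td K n.
Proof.
elim/ltn_ind: n => n IHn n_gt0 hn.
have [->|n_neq1] := eqVneq n 1; first exact: has_td1.
have n_gt1 : 1 < n by rewrite ltn_neqAle eq_sym n_neq1.
have p_pr := pdiv_prime n_gt1; set p := pdiv n in p_pr.
have p_dvd : p %| n by exact: pdiv_dvd.
have [n' cop En] := pfactor_coprime p_pr n_gt0.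
have e_gt0 : 0 < logn p n by rewrite logn_gt0 mem_primes p_pr n_gt0.
have pe_gt1 : 1 < p ^ logn p n by rewrite -[1](expn0 p) ltn_exp2l ?prime_gt1.
have n'_gt0 : 0 < n' by move: n_gt0; rewrite [in 0 < n]En muln_gt0; case/andP.
rewrite En; apply: has_td_mul.
  apply: IHn => //; first by rewrite [ltnRHS]En -[ltnLHS]muln1 ltn_pmul2l.
  (* The hypothesis passes to [n']: a prime [r] dividing [n'] differs from [p], so its powers are
     coprime to the factor split off. *)
  move=> r r_pr le_r r_dvd.
  have r_n : r %| n by rewrite En dvdn_mulr.
  have := hn r r_pr le_r r_n; rewrite En Gauss_dvdl //.
  apply: coprimeXl; apply: coprimeXr; rewrite prime_coprime // dvdn_prime2 //.
  by apply: contraTneq cop => <-; rewrite prime_coprime // r_dvd.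
apply: has_td_prime_power => //.
have [le_p|lt_p] := leqP p #|K|.
  have := hn p p_pr le_p p_dvd; rewrite pfactor_dvdn // => le_e.
  apply: leq_trans (ltnW (ltn_expl _ (prime_gt1 p_pr))) _.
  by rewrite leq_exp2l ?prime_gt1.
apply: leq_trans (ltnW lt_p) _; rewrite -[leqLHS]expn1 leq_exp2l ?prime_gt1 //.
Qed.

End TransversalDesigns.

(** * Wilson's construction with one truncated group *)

Section Wilson.
Local Open Scope nat_scope.

Variables (K : eqType) (T U M : Type) (iota : U -> T).
Hypothesis iota_inj : injective iota.
Variables (BT : (option K -> T) -> Prop) (BM : (K -> M) -> Prop)
  (BM1 : (K -> option M) -> Prop) (BU : (K -> U) -> Prop).

(* A block of [BT] whose last coordinate lies outside the truncated group is
   inflated by [BM]; one that meets the truncated group is inflated by [BM1]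
   deprived of the constant block [None]. *)
Inductive wilson (f : K -> T * M + U) : Prop :=
| WilsonOut beta g of BT beta & (forall y, beta None <> iota y) & BM g &
    (forall i, f i = inl (beta (Some i), g i))
| WilsonIn beta y g of BT beta & beta None = iota y & BM1 g &
    (exists i, g i <> None) &
    (forall i, f i = if g i is Some z then inl (beta (Some i), z) else inr y)
| WilsonSub h of BU h & (forall i, f i = inr (h i)).

Hypotheses (tdT : td BT) (tdM : td BM) (tdM1 : td BM1) (tdU : td BU).
Hypothesis BM1_None : BM1 (fun=> None).

(** Two points are joined by a block of [BT] through their projections, a point of [U] being
    projected to the truncated group, and then inside the inflation of that block; two points of [U]
    are joined by [BU]. Conversely, two common points determine the [BT] block and thereby the
    ingredient in use. *)
Lemma wilson_td : td wilson.
Proof.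
case: tdT tdM tdM1 tdU => [exT uT] [exM uM] [exM1 uM1] [exU uU].
have uT' i j b b' : i != j -> BT b -> BT b' -> b (Some i) = b' (Some i) ->
    b (Some j) = b' (Some j) -> b =1 b'.
  by move=> neq Bb Bb'; exact: (uT (Some i) (Some j) _ _ neq Bb Bb').
(* An inflated block meets the copy of [U] at most once: a second [None] would make [g] the constant
   block, which is excluded. This separates it from the blocks of [BU]. *)
have notNone g i j : i != j -> BM1 g -> (exists i, g i <> None) ->
    g i = None -> g j = None -> False.
  move=> neq Bg [l gl] gi gj; apply: gl.
  by rewrite (uM1 i j _ _ neq Bg BM1_None gi gj).
split.
  have sym i j a b : (exists f, [/\ wilson f, f j = b & f i = a]) ->
    exists f, [/\ wilson f, f i = a & f j = b] by case=> f []; exists f.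
  have mixed i j x z y : i != j ->
      exists f, [/\ wilson f, f i = inl (x, z) & f j = inr y].
    move=> neq.
    have [b [Bb bi bN]] := exT (Some i) None x (iota y) isT.
    have [g [Bg gi gj]] := exM1 i j (Some z) None neq.
    exists (fun l => if g l is Some z then inl (b (Some l), z) else inr y).
    rewrite gi gj bi; split=> //; apply: (WilsonIn Bb bN Bg) => //.
    by exists i; rewrite gi.
  move=> i j [[x z]|y] [[x' z']|y'] neq.
  - have [b [Bb bi bj]] := exT (Some i) (Some j) x x' neq.
    have [[y bN]|nb] := pselect (exists y, b None = iota y).
      have [g [Bg gi gj]] := exM1 i j (Some z) (Some z') neq.
      exists (fun l => if g l is Some z then inl (b (Some l), z) else inr y).
      rewrite gi gj bi bj; split=> //; apply: (WilsonIn Bb bN Bg) => //.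
      by exists i; rewrite gi.
    have [g [Bg gi gj]] := exM i j z z' neq.
    exists (fun l => inl (b (Some l), g l)); rewrite gi gj bi bj; split=> //.
    by apply: (WilsonOut Bb _ Bg) => // y bN; apply: nb; exists y.
  - exact: mixed.
  - by apply: sym; apply: mixed; rewrite eq_sym.
  - have [h [Bh hi hj]] := exU i j y y' neq.
    by exists (fun l => inr (h l)); rewrite hi hj; split=> //; apply: (WilsonSub Bh).
move=> i j f f' neq.
(* Two shared points force equal [BT] blocks, but one of these meets the truncated part and the
   other does not. *)
have out_in b g b' y g' : BT b -> (forall y, b None <> iota y) -> BT b' ->
    b' None = iota y -> (forall l, f l = inl (b (Some l), g l)) ->
    (forall l, f' l = if g' l is Some z then inl (b' (Some l), z) else inr y) ->
    f i = f' i -> f j = f' j -> False.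
  move=> Bb nb Bb' b'N Ef Ef'; rewrite !Ef !Ef'.
  case: (g' i) => // z1 [e1 _]; case: (g' j) => // z2 [e2 _].
  by apply: (nb y); rewrite (uT' i j _ _ neq Bb Bb').
have in_out b g b' y g' : BT b -> (forall y, b None <> iota y) -> BT b' ->
    b' None = iota y -> (forall l, f' l = inl (b (Some l), g l)) ->
    (forall l, f l = if g' l is Some z then inl (b' (Some l), z) else inr y) ->
    f i = f' i -> f j = f' j -> False.
  move=> Bb nb Bb' b'N Ef Ef'; rewrite !Ef !Ef'.
  case: (g' i) => // z1 [e1 _]; case: (g' j) => // z2 [e2 _].
  by apply: (nb y); rewrite -(uT' i j _ _ neq Bb' Bb).
case=> [b g Bb nb Bg Ef|b y g Bb bN Bg gN Ef|h Bh Ef];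
  case=> [b' g' Bb' nb' Bg' Ef'|b' y' g' Bb' bN' Bg' gN' Ef'|h' Bh' Ef'].
- rewrite !Ef !Ef' => -[bi gi] [bj gj] l; rewrite Ef Ef'.
  by rewrite (uT' i j b b') // (uM i j g g').
- by move=> e1 e2; case: (out_in b g b' y' g').
- by rewrite Ef Ef'.
- by move=> e1 e2; case: (in_out b' g' b y g).
- move=> ei ej.
  suff [bb' [yy' gg']] : b =1 b' /\ y = y' /\ g =1 g'.
    by move=> l; rewrite Ef Ef' yy' gg'; case: (g' l) => // z; rewrite bb'.
  move: ei ej; rewrite !Ef !Ef'.
  (* A shared point of [U] gives the [None] coordinate of both [BT] blocks, so any two shared
     points, at most one of them in [U], determine the block. *)
  case gi: (g i) => [z|]; case gi': (g' i) => [z'|] //;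
  case gj: (g j) => [w|]; case gj': (g' j) => [w'|] //.
  + move=> [bi zz] [bj ww]; have bb' := uT' _ _ _ _ neq Bb Bb' bi bj.
    split=> //; split; first by apply: iota_inj; rewrite -bN -bN' bb'.
    by apply: (uM1 i j) => //; rewrite ?gi ?gi' ?gj ?gj' ?zz ?ww.
  + move=> [bi zz] [yy]; split; last first.
      by split=> //; apply: (uM1 i j) => //; rewrite ?gi ?gi' ?gj ?gj' ?zz.
    by apply: (uT (Some i) None) => //; rewrite bN bN' yy.
  + move=> [yy] [bj ww]; split; last first.
      by split=> //; apply: (uM1 i j) => //; rewrite ?gi ?gi' ?gj ?gj' ?ww.
    by apply: (uT (Some j) None) => //; rewrite bN bN' yy.
  + by case: (notNone g i j).
- move=> ei ej; case: (notNone g i j) => //.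
    by move: ei; rewrite Ef Ef'; case: (g i).
  by move: ej; rewrite Ef Ef'; case: (g j).
- by rewrite Ef Ef'.
- move=> ei ej; case: (notNone g' i j) => //.
    by move: ei; rewrite Ef Ef'; case: (g' i).
  by move: ej; rewrite Ef Ef'; case: (g' j).
- rewrite !Ef !Ef' => -[hi] [hj] l; rewrite Ef Ef'; congr inr.
  exact: (uU i j).
Qed.

End Wilson.

(** * Designs containing a smaller design *)

Section SubDesign.
Local Open Scope nat_scope.

Definition sub_td (K : Type) (Q G : Type) (BQ : (K -> Q) -> Prop)
    (B : (K -> G) -> Prop) (e : K -> Q -> G) : Prop :=
  (forall i, injective (e i)) /\
  forall h, BQ h -> exists2 f, B f & forall i, f i = e i (h i).

(** Distinct blocks through one point of the extra group [None] meet nowhere else. *)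
Lemma two_disjoint_blocks (K : eqType) (G : Type) (i0 : K)
    (B : (option K -> G) -> Prop) (a b : G) : a <> b -> td B ->
  exists f g, [/\ B f, B g & forall i, f (Some i) <> g (Some i)].
Proof.
move=> neq [exB uB].
have [f [Bf f0 f1]] := exB None (Some i0) a a isT.
have [g [Bg g0 g1]] := exB None (Some i0) a b isT.
exists f, g; split=> // i e; apply: neq.
by rewrite -f1 -g1 (uB None (Some i) f g) // f0 g0.
Qed.

(** In the product, the block formed by [h0] and [r0] is disjoint from the copy of [BQ] lying over
    [r1], because [r0] and [r1] are disjoint. Renaming that block to the constant [None] leaves the
    copy inside [Some]. *)
Lemma td_mul_sub (K : eqType) (Q R : Type) (M : finType) (i0 : K) (a b : R)
    (BQ : (K -> Q) -> Prop) (BR : (option K -> R) -> Prop)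
    (phi : forall z : Q * R, exists2 f : Q * R -> option M, bijective f & f z = None)
    (q0 : Q) : a <> b -> td BQ -> td BR -> (exists j, j != i0) ->
  exists (B : (K -> option M) -> Prop) (e : K -> Q -> M),
    [/\ td B, B (fun=> None) & sub_td BQ B (fun i x => Some (e i x))].
Proof.
move=> neq tdQ tdR [j0 ne0].
have [r0 [r1 [Br0 Br1 disj]]] := two_disjoint_blocks i0 neq tdR.
have [h0 [Bh0 _ _]] := tdQ.1 j0 i0 q0 q0 ne0.
pose z i := (h0 i, r0 (Some i)).
have /choice[F Fp] : forall i, exists f : Q * R -> option M, bijective f /\ f (z i) = None.
  by move=> i; have [f] := phi (z i); exists f.
have tdR' := td_sub (s := Some) (@Some_inj _) tdR.
have tdQR := td_prod tdQ tdR'.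
have Finj i : injective (F i) by exact: bij_inj (Fp i).1.
have /choice[E Ep] : forall ix, exists y, F ix.1 (ix.2, r1 (Some ix.1)) = Some y.
  move=> [i x] /=; case D: (F i _) => [y|]; first by exists y.
  by move: D; rewrite -(Fp i).2 => /Finj[_ /esym/disj].
eexists; exists (fun i x => E (i, x)); split.
- exact: (td_rename (fun i => (Fp i).1) tdQR).
- exists z; last by move=> i; rewrite (Fp i).2.
  by exists h0, (fun i => r0 (Some i)); split=> //; exists r0.
split; first by move=> i x y; rewrite -!(Ep (i, _)) => /Finj[].
move=> h Bh; exists (fun i => Some (E (i, h i))) => //.
exists (fun i => (h i, r1 (Some i))); last by move=> i; rewrite -(Ep (i, h i)).
by exists h, (fun i => r1 (Some i)); split=> //; exists r1.
Qed.

(** A subdesign of [BM1] that misses [None] survives in the inflation of any block of [BT] meeting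
    the truncated group. *)
Lemma wilson_sub (K : eqType) (T U M Q : Type) (iota : U -> T) (i0 : K) (y : U)
    (t : T) (BT : (option K -> T) -> Prop) (BM : (K -> M) -> Prop)
    (BM1 : (K -> option M) -> Prop) (BU : (K -> U) -> Prop)
    (BQ : (K -> Q) -> Prop) (e : K -> Q -> M) :
    td BT -> sub_td BQ BM1 (fun i x => Some (e i x)) ->
  exists e', sub_td BQ (wilson iota BT BM BM1 BU) e'.
Proof.
move=> [exT _] [e_inj sub].
have [b [Bb _ bN]] := exT (Some i0) None t (iota y) isT.
exists (fun i x => inl (b (Some i), e i x)); split.
  by move=> i x x' [xx']; apply: (e_inj i); rewrite xx'.
move=> h Bh; have [f Bf Ef] := sub h Bh.
exists (fun i => inl (b (Some i), e i (h i))) => //.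
apply: (WilsonIn _ _ Bb bN Bf); first by exists i0; rewrite Ef.
by move=> i; rewrite Ef.
Qed.

End SubDesign.

(** * Designs of all large orders *)

Section LargeOrders.
Local Open Scope nat_scope.

Lemma prime_power_dvd_fact (p k : nat) : prime p -> p <= k -> p ^ k %| k`! ^ k.
Proof. by move=> p_pr le_pk; rewrite dvdn_exp2r // dvdn_fact // prime_gt0. Qed.

Lemma eqmod_dvd (d D a b : nat) : d %| D -> a = b %[mod D] -> a = b %[mod d].
Proof. by move=> dD e; rewrite -(modn_dvdm a dD) e modn_dvdm. Qed.

(* With [t = (n+1)^(k!+1) - n] modulo [D], Fermat's little theorem gives [t = 1]
   modulo every prime [p <= k], while [u = n - m t] is [(n+1)^(k!+1)] modulo [D],
   hence divisible by [p ^ k] as soon as it is divisible by [p]. *)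
Lemma no_small_prime_power_split (k q m n : nat) : 0 < k -> 0 < m ->
    m.+1 = q * k`! ^ k -> (m.+1 * m.+1 * k`! ^ k).+1 <= n ->
  exists t u, [/\ n = m * t + u, 0 < u <= t, no_small_prime_power k t &
    no_small_prime_power k u].
Proof.
set D := k`! ^ k => k_gt0 m_gt0 Em len.
have D_gt0 : 0 < D by rewrite expn_gt0 fact_gt0.
(* The exponent is 1 modulo [p - 1] for every prime [p <= k], as Fermat's theorem requires, and at
   least [k], as divisibility of [u] by [p ^ k] requires. *)
set x := n.+1 ^ (k`!).+1.
pose c := n.-1 %/ m.
(* [D.-1 * x] stands for [- x] modulo [D]; subtracting [r] lowers [c], the largest number with
   [m * c < n], to the residue of [x - n]. *)
pose r := (c + n + D.-1 * x) %% D.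
have lt_r : r < D by rewrite ltn_mod.
(* Source of the threshold on [n]. With [s = n.-1 %% m] one has [u = m * r + s + 1], so [u <= t]
   means [m.+1 * r + s + 1 <= c], where [r < D] and [s < m]. *)
have le_c : m.+1 * D <= c.
  rewrite leq_divRL // -ltnS (ltn_predK len); apply: leq_ltn_trans len.
  by rewrite mulnAC leq_mul2r leq_mul2l leqnSn !orbT.
have le_rc : r <= c.
  by apply: leq_trans le_c; apply: leq_trans (ltnW lt_r) _; rewrite leq_pmull.
pose t := c - r.
have Ec : n.-1 = c * m + n.-1 %% m by exact: divn_eq.
have lt_s : n.-1 %% m < m by rewrite ltn_mod.
have En : n = (c * m + n.-1 %% m).+1 by rewrite -Ec (ltn_predK len).
set s := n.-1 %% m in En lt_s.
have Ecrt : c = t + r by rewrite subnK.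
have le_mt : m * t < n.
  by rewrite En ltnS mulnC (leq_trans _ (leq_addr _ _)) // leq_mul2r leq_subr orbT.
exists t, (n - m * t); have tD : t + n = x %[mod D].
  apply/eqP; rewrite -(eqn_modDr r) addnAC -Ecrt; apply/eqP.
  rewrite /r modnDmr addnCA -mulSn (ltn_predK D_gt0).
  by rewrite mulnC (addnC (c + n)) modnMDl.
have uD : n - m * t = x %[mod D].
  rewrite -tD -(modnMDl (q * t)) mulnAC -Em; congr (_ %% D).
  by rewrite mulSn -addnA subnKC // ltnW.
have pD p : prime p -> p <= k -> p %| D.
  move=> p_pr le_p; apply: dvdn_trans (prime_power_dvd_fact p_pr le_p).
  by rewrite -[X in X %| _]expn1 dvdn_exp2l.
split.
- by rewrite subnKC // ltnW.
- rewrite subn_gt0 le_mt /=; rewrite leq_subLR.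
  have : m.+1 * r.+1 <= c by apply: leq_trans le_c; rewrite leq_mul2l lt_r.
  by clear -En lt_s Ecrt; rewrite En Ecrt; lia.
- move=> p p_pr le_p p_t; exfalso; have tp := eqmod_dvd (pD p p_pr le_p) tD.
  have [p_n|p_n] := boolP (p %| n.+1).
    have : p %| x by rewrite /x expnS dvdn_mulr.
    rewrite /dvdn -tp -[_ == 0]/(p %| t + n) dvdn_addr // => p_n'.
    have : p %| 1 by rewrite -(dvdn_addr _ p_n') addn1.
    by rewrite dvdn1 => /eqP p1; rewrite p1 in p_pr.
  have cop : coprime n.+1 p by rewrite coprime_sym prime_coprime.
  have /dvdnP[e Ee] : p.-1 %| k`!.
    by rewrite dvdn_fact //; have := prime_gt1 p_pr; clear -le_p; lia.
  have xp : x = n.+1 %[mod p].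
    rewrite /x Ee expnS (mulnC e) expnM -modnMmr -modnXm.
    have := Euler_exp_totient cop; rewrite totient_prime // => ->.
    by rewrite modnXm exp1n modnMmr muln1.
  move/eqP: tp; rewrite xp -addn1 addnC eqn_modDl (eqP p_t).
  by rewrite modn_small ?prime_gt1.
move=> p p_pr le_p p_u.
have up := eqmod_dvd (pD p p_pr le_p) uD.
have p_n : p %| n.+1.
  by move: p_u; rewrite /dvdn up -[_ == 0]/(p %| x) /x Euclid_dvdX // => /andP[].
have uk := eqmod_dvd (prime_power_dvd_fact p_pr le_p) uD.
rewrite /dvdn uk -[_ == 0]/(p ^ k %| x) /x.
apply: dvdn_trans (dvdn_exp2l _ (_ : k <= (k`!).+1)); first by rewrite dvdn_exp2r.
by apply: leqW; rewrite dvdn_leq ?fact_gt0 // dvdn_fact // k_gt0 leqnn.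
Qed.

Lemma td_large_sub (q : nat) (BQ : ('I_q.+1 -> 'I_q) -> Prop) :
    1 < q -> td BQ ->
  exists N, forall n, N <= n -> exists (G : finType)
      (B : ('I_q.+1 -> G) -> Prop) (e : 'I_q.+1 -> 'I_q -> G),
    [/\ #|G| = n, td B & sub_td BQ B e].
Proof.
move=> q_gt1 tdQ; have q_gt0 := ltnW q_gt1.
(* [k] counts the [q + 1] groups and the extra group [None], used for truncation and for the two
   disjoint blocks. *)
pose k := #|{: option 'I_q.+1}|; pose D := k`! ^ k.
have Ek : k = q.+2 by rewrite /k card_option card_ord.
have k_gt0 : 0 < k by rewrite Ek.
have D_gt1 : 1 < D.
  rewrite /D -[1](expn0 k`!) ltn_exp2l ?Ek //.
  by rewrite factS; apply: leq_trans (leq_pmulr _ (fact_gt0 _)).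
pose m := (q * D).-1.
have m_gt0 : 0 < m by rewrite /m; clearbody D; nia.
have Em : m.+1 = q * D by rewrite /m; clearbody D; nia.
have good n : 0 < n -> no_small_prime_power k n -> has_td (option 'I_q.+1) n.
  exact: has_td_no_small_prime_power.
have restr n : has_td (option 'I_q.+1) n -> has_td 'I_q.+1 n.
  by move=> [B /(td_sub (@Some_inj _)) tdB]; eexists; exact: tdB.
have [|BD tdD] := good D (ltnW D_gt1).
  by move=> p p_pr le_p _; exact: prime_power_dvd_fact.
(* [m = q * D - 1] is prime to every [p <= k], so the condition holds vacuously. *)
have [|BM tdM] := restr _ (good m m_gt0 _).
  move=> p p_pr le_p p_m; exfalso.
  have p_D : p %| D.
    apply: dvdn_trans (prime_power_dvd_fact p_pr le_p).
    by rewrite -[X in X %| _]expn1 dvdn_exp2l.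
  have : p %| 1 by rewrite -(dvdn_addr _ p_m) addn1 Em dvdn_mull.
  by rewrite dvdn1 => /eqP p1; rewrite p1 in p_pr.
exists (m.+1 * m.+1 * D).+1 => n le_n.
have [t [u [En /andP[u_gt0 le_ut] good_t good_u]]] :=
  no_small_prime_power_split k_gt0 m_gt0 Em le_n.
have [BT tdT] := good t (leq_trans u_gt0 le_ut) good_t.
have [BU tdU] := restr _ (good u u_gt0 good_u).
have phi (z : 'I_q * 'I_D) :
    exists2 f : 'I_q * 'I_D -> option 'I_m, bijective f & f z = None.
  by apply: card_bij_at; rewrite card_option card_prod !card_ord.
have neq : Ordinal (ltnW D_gt1) <> Ordinal D_gt1 by case.
have ne01 : exists j : 'I_q.+1, j != ord0.
  by exists ord_max; rewrite -val_eqE /= -lt0n.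
have [B1 [e [td1 B1N sub1]]] :=
  td_mul_sub phi (Ordinal q_gt0) neq tdQ tdD ne01.
have iota_inj : injective (widen_ord le_ut).
  by move=> i j /(congr1 val)/= /val_inj.
have [e' sube'] := wilson_sub (widen_ord le_ut) ord0 (Ordinal u_gt0)
  (widen_ord le_ut (Ordinal u_gt0)) BM BU tdT sub1.
exists (('I_t * 'I_m + 'I_u)%type : finType).
exists (wilson (widen_ord le_ut) BT BM B1 BU), e'; split=> //.
  by rewrite card_sum card_prod !card_ord mulnC -En.
exact: wilson_td.
Qed.

End LargeOrders.

(** * Affine planes and orthogonal arrays *)

Section AffinePlanes.
Local Open Scope nat_scope.

Lemma card_set_label (T : finType) (C : {set T}) (q : nat) : #|C| = q ->
  exists phi : T -> 'I_q.-1.+1, {in C &, injective phi} /\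
    forall j : 'I_q, exists2 M, M \in C & phi M = j :> nat.
Proof.
move=> cardC; exists (fun M => inord (index M (enum C))); split.
  have idx M : M \in C -> index M (enum C) < q.-1.+1.
    move=> MC; apply: leq_trans (leqSpred q); rewrite -cardC cardE index_mem.
    by rewrite mem_enum.
  move=> M N MC NC /(congr1 val)/=; rewrite !inordK ?idx // => e.
  by rewrite -(nth_index M (_ : M \in enum C)) ?e ?nth_index ?mem_enum.
move=> j; have ltj : j < size (enum C) by rewrite -cardE cardC.
case D: (enum C) => [|M0 s]; first by rewrite D in ltj.
exists (nth M0 (enum C) j); first by rewrite -mem_enum mem_nth.
rewrite -D index_uniq ?enum_uniq // inordK //.
by apply: leq_trans (ltn_ord j) (leqSpred q).
Qed.

Variables (q : nat) (P : finType) (Ls : {set {set P}}).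
Hypotheses (q_gt1 : 1 < q) (plane : affine_plane q Ls).

Let two_points x y M N : x != y -> M \in Ls -> N \in Ls ->
  x \in M -> y \in M -> x \in N -> y \in N -> M = N.
Proof.
move: plane => [[[_ _ pls] _ _] _] neq ML NL xM yM xN yN; apply/eqP.
apply: contraLR (pls x y neq) => neqMN; rewrite -ltnNge.
have -> : 2 = #|[set M; N]| by rewrite cards2 neqMN.
apply: subset_leq_card; apply/subsetP => L; rewrite !inE.
by case/orP=> /eqP->; rewrite ?ML ?xM ?yM ?NL ?xN ?yN.
Qed.

Let parallel p L : L \in Ls -> p \notin L ->
  (exists M, [/\ M \in Ls, p \in M & [disjoint M & L]]) /\
  forall M N, M \in Ls -> N \in Ls -> p \in M -> p \in N ->
    [disjoint M & L] -> [disjoint N & L] -> M = N.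
Proof.
move: plane => [_ par] LL pL; have [M [HM uM]] := par p L LL pL; split.
  by exists M.
by move=> N N' *; rewrite -(uM N) ?(uM N').
Qed.

(** Parallel classes are indexed by the [q + 1] lines through one point [p0]; a point of the plane
    becomes the block of the lines through it. *)
Lemma affine_plane_td : exists B : ('I_q.+1 -> 'I_q) -> Prop, td B.
Proof.
move: (plane) => [[[/card_gt0P[p0 _] _ _] deg size_line] _].
have q0 : q = q.-1.+1 by rewrite prednK // ltnW.
pose Lp := [set L in Ls | p0 \in L].
have cLp : q.+1 = #|Lp| by rewrite deg.
pose l (i : 'I_q.+1) : {set P} := enum_val (cast_ord cLp i).
have l_Lp i : (l i \in Ls) && (p0 \in l i).
  by have := enum_valP (cast_ord cLp i); rewrite inE.
have lL i : l i \in Ls by case/andP: (l_Lp i).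
have p0l i : p0 \in l i by case/andP: (l_Lp i).
have l_inj : injective l by move=> i j /enum_val_inj/cast_ord_inj.
have dis (M N : {set P}) x : [disjoint M & N] -> x \in M -> x \in N -> False.
  by move=> d xM; rewrite (disjointFr d xM).
pose cl i := [set M in Ls | (M == l i) || [disjoint M & l i]].
have clL i M : M \in cl i -> M \in Ls by rewrite inE => /andP[].
have l_cl i : l i \in cl i by rewrite inE lL eqxx.
have cl_l i j : i != j -> l j \notin cl i.
  move=> neq; rewrite inE lL /= (inj_eq l_inj) eq_sym (negbTE neq) /=.
  by apply/negP => d; exact: (dis _ _ _ d (p0l j) (p0l i)).
have cl_ex i x : exists2 M, M \in cl i & x \in M.
  have [xl|xl] := boolP (x \in l i); first by exists (l i).
  have [[M [ML xM d]] _] := parallel (lL i) xl.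
  by exists M; rewrite // inE ML d orbT.
have cl_uniq i x M N : M \in cl i -> N \in cl i -> x \in M -> x \in N -> M = N.
  rewrite !inE => /andP[ML /orP[/eqP->|dM]] /andP[NL /orP[/eqP->|dN]] // xM xN.
  - by case: (dis _ _ x dN).
  - by case: (dis _ _ x dM).
  have [_ u] := parallel (lL i) (negbT (disjointFr dM xM)).
  exact: u.
(* If [M] missed [l j], then [l i] and [l j] would be two parallels to [M] through [p0]. *)
have cl_meet_l i j M : i != j -> M \in cl i -> exists2 x, x \in M & x \in l j.
  move=> neq; rewrite inE => /andP[ML /orP[/eqP->|dM]]; first by exists p0.
  apply/exists_inP; apply: contraTT isT; rewrite negb_exists_in => /forall_inP nd.
  have p0M : p0 \notin M.
    by apply/negP => p0M; exact: (dis _ _ _ dM p0M (p0l i)).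
  have [_ u] := parallel ML p0M.
  suff /l_inj/eqP : l i = l j by rewrite (negbTE neq).
  apply: u => //; first by rewrite disjoint_sym.
  by rewrite disjoint_sym disjoint_subset; apply/subsetP => x /nd.
(* If [M] and [N] were disjoint, then [M] and [l j] would be two parallels to [N] through a common
   point. *)
have cl_meet i j M N : i != j -> M \in cl i -> N \in cl j ->
    exists2 x, x \in M & x \in N.
  move=> neq Mi Nj; have [y yM yl] := cl_meet_l i j M neq Mi.
  apply/exists_inP; apply: contraTT isT; rewrite negb_exists_in => /forall_inP nd.
  have dMN : [disjoint M & N] by rewrite disjoint_subset; apply/subsetP => x /nd.
  have Mlj : M != l j by apply: contraNneq (cl_l _ _ neq) => <-.
  have yN : y \notin N by exact: nd.
  have dlN : [disjoint l j & N].
    move: Nj; rewrite inE => /andP[_ /orP[/eqP E|]]; last by rewrite disjoint_sym.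
    by rewrite E yl in yN.
  have [_ u] := parallel (clL _ _ Nj) yN.
  by case/eqP: Mlj; apply: u; rewrite ?(clL _ _ Mi).
(* Mapping each of the [q] points of a transversal line [l j] to its line of class [i] is a
   bijection onto the class. *)
have card_cl i : #|cl i| = q.
  have [j neq] : exists j, i != j.
    exists (if i == ord0 then ord_max else ord0); case: (eqVneq i ord0) => [->|] //=.
    by rewrite -val_eqE /= eq_sym -lt0n ltnW.
  have /choice[f fP] : forall x, exists M, M \in cl i /\ x \in M.
    by move=> x; have [M] := cl_ex i x; exists M.
  rewrite q0 -(size_line _ (lL j)) -(card_in_imset (f := f)).
    apply: eq_card => M; apply/idP/imsetP => [Mi|[x xl ->]]; last by have [] := fP x.
    have [x xM xl] := cl_meet_l i j M neq Mi; exists x => //.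
    by have [fi fx] := fP x; exact: (cl_uniq i x).
  move=> x y xl yl exy; apply/eqP; apply: contraNT (cl_l _ _ neq) => nxy.
  have [fi fx] := fP x; have [_ fy] := fP y.
  by rewrite (two_points nxy (lL j) (clL _ _ fi)) // exy.
have /choice[phi phiP] : forall i, exists phi : {set P} -> 'I_q,
    {in cl i &, injective phi} /\ forall j, exists2 M, M \in cl i & phi M = j.
  move=> i; have [phi [inj surj]] := card_set_label (card_cl i).
  exists (fun M => cast_ord (esym q0) (phi M)); split.
    by move=> M N Mi Ni /cast_ord_inj/inj->.
  by move=> j; have [M Mi e] := surj j; exists M => //; apply: val_inj.
have /choice[ln lnP] : forall ix, exists M, M \in cl ix.1 /\ ix.2 \in M.
  by move=> ix; have [M] := cl_ex ix.1 ix.2; exists M.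
exists (fun f => exists x, forall i, f i = phi i (ln (i, x))); split.
  move=> i j a b neq.
  have [M Mi <-] := (phiP i).2 a; have [N Nj <-] := (phiP j).2 b.
  have [x xM xN] := cl_meet i j M N neq Mi Nj.
  exists (fun l => phi l (ln (l, x))); split; first by exists x.
    by have [Li Lx] := lnP (i, x); rewrite (cl_uniq i x M (ln (i, x))).
  by have [Li Lx] := lnP (j, x); rewrite (cl_uniq j x N (ln (j, x))).
move=> i j f g neq [x Ef] [y Eg]; rewrite !Ef !Eg.
have [/= xi xi'] := lnP (i, x); have [/= yi yi'] := lnP (i, y).
have [/= xj xj'] := lnP (j, x); have [/= yj yj'] := lnP (j, y).
move=> /((phiP i).1 _ _ xi yi) ei /((phiP j).1 _ _ xj yj) ej.
suff E : x = y by move=> h; rewrite Ef Eg E.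
apply/eqP; apply/negPn/negP => nxy.
(* This line lies in both classes. Being in [cl j] and meeting [l j] it equals [l j], which is not
   in [cl i]. *)
have E : ln (i, x) = ln (j, x).
  by apply: (two_points nxy); rewrite ?(clL _ _ xi) ?(clL _ _ xj) // ?ei ?ej.
have [y' y'M y'l] := cl_meet_l i j _ neq xi.
have [] := negP (cl_l _ _ neq).
suff <- : ln (i, x) = l j by [].
have : ln (i, x) \in cl j by rewrite E.
rewrite inE => /andP[_ /orP[/eqP->//|d]].
by case: (dis _ _ y' d).
Qed.

End AffinePlanes.

(** * Nets in coordinates *)

Section OrthogonalArrays.
Local Open Scope nat_scope.

(* The points of a net in coordinates: [c i x] is the line of class [i] through [x]. *)
Definition oa (k : nat) (P G : finType) (c : 'I_k -> P -> G) : Prop :=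
  (forall i j a b, i != j -> exists2 x, c i x = a & c j x = b) /\
  (forall i j x y, i != j -> c i x = c i y -> c j x = c j y -> x = y).

(** For [k = q + 1] this is an embedded affine plane of order [q], described by the lines that carry
    a point of [S], so that these need no labels of their own. *)
Definition oa_sub (q k : nat) (P G : finType) (c : 'I_k -> P -> G)
    (S : {set P}) : Prop :=
  [/\ exists s, s \in S,
      forall i j s s', i != j -> s \in S -> s' \in S ->
        exists2 r, r \in S & c i r = c i s /\ c j r = c j s' &
      forall i s, s \in S -> #|[set r in S | c i r == c i s]| = q].

(** Points of the net are the blocks of the design. Since [B] is only a predicate, a block is
    encoded by its values in two groups, which gives the finite type [G * G]. *)
Lemma oa_of_td (q k : nat) (G : finType) (B : ('I_k.+2 -> G) -> Prop)
    (BQ : ('I_k.+2 -> 'I_q) -> Prop) (e : 'I_k.+2 -> 'I_q -> G) :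
    0 < q -> td B -> td BQ -> sub_td BQ B e ->
  exists (P : finType) (c : 'I_k.+2 -> P -> G) (S : {set P}),
    oa c /\ oa_sub q c S.
Proof.
move=> q_gt0 [exB uB] [exQ uQ] [e_inj sub].
have neq01 : ord0 != ord_max :> 'I_k.+2 by [].
have /choice[bl blP] : forall p : G * G, exists f,
    [/\ B f, f ord0 = p.1 & f ord_max = p.2] by move=> p; exact: exB.
pose c (i : 'I_k.+2) (p : (G * G)%type) : G := bl p i.
have blE f : B f -> bl (f ord0, f ord_max) =1 f.
  move=> Bf; have [Bb b0 b1] := blP (f ord0, f ord_max).
  exact: (uB ord0 ord_max).
have bl_inj p p' : bl p =1 bl p' -> p = p'.
  move=> E; have [_ b0 b1] := blP p; have [_ b0' b1'] := blP p'.
  by rewrite [p]surjective_pairing [p']surjective_pairing -b0 -b1 -b0' -b1' !E.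
pose inS p := exists2 h, BQ h & forall i, bl p i = e i (h i).
have inS_of h : BQ h -> exists2 p, inS p & forall i, bl p i = e i (h i).
  move=> Bh; have [f Bf Ef] := sub h Bh; exists (f ord0, f ord_max).
    by exists h => // i; rewrite blE.
  by move=> i; rewrite blE.
exists ((G * G)%type : finType), c, [set p | `[< inS p >]]; split; split.
- move=> i j a b neq; have [f [Bf <- <-]] := exB i j a b neq.
  by exists (f ord0, f ord_max); exact: blE.
- move=> i j x y neq ei ej; apply: bl_inj.
  by have [Bx _ _] := blP x; have [By _ _] := blP y; exact: (uB i j).
- have [h [Bh _ _]] := exQ ord0 ord_max (Ordinal q_gt0) (Ordinal q_gt0) neq01.
  by have [p Sp _] := inS_of h Bh; exists p; rewrite inE; apply/asboolP.
- move=> i j s s' neq; rewrite !inE => /asboolP[h Bh Eh] /asboolP[h' Bh' Eh'].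
  have [g [Bg gi gj]] := exQ i j (h i) (h' j) neq.
  have [p Sp Ep] := inS_of g Bg; exists p; first by rewrite inE; apply/asboolP.
  by rewrite /c !Ep Eh Eh' gi gj.
move=> i s; rewrite inE => /asboolP[h Bh Eh].
have [j neq] : exists j, i != j.
  by exists (if i == ord0 then ord_max else ord0); case: (eqVneq i ord0) => [->|].
(* A point of [S] on the given line is determined by its coordinate in another class [j], which runs
   through the image of [e j]. *)
rewrite -[RHS](card_ord q) -(card_imset _ (e_inj j)).
rewrite -(card_in_imset (f := c j)); last first.
  move=> x y; rewrite !inE => /andP[_ /eqP xi] /andP[_ /eqP yi] xy.
  apply: bl_inj; have [Bx _ _] := blP x; have [By _ _] := blP y.
  by apply: (uB i j) => //; exact: etrans xi (esym yi).
apply: eq_card => a; apply/imsetP/imsetP => [[r]|[b _ ->]].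
  rewrite !inE => /andP[/asboolP[g Bg Eg] _] ->; exists (g j); first by [].
  by rewrite -Eg.
have [g [Bg gi gj]] := exQ i j (h i) b neq.
have [p Sp Ep] := inS_of g Bg; exists p; last by rewrite /c Ep gj.
by rewrite !inE /c Ep Eh gi eqxx andbT; apply/asboolP.
Qed.

Lemma oa_large_sub (q : nat) (P : finType) (Ls : {set {set P}}) : 1 < q ->
    affine_plane q Ls ->
  exists N, forall n, N <= n -> exists (P : finType) (G : finType)
      (c : 'I_q.+1 -> P -> G) (S : {set P}), [/\ #|G| = n, oa c & oa_sub q c S].
Proof.
move=> q_gt1 plane; have [BQ tdQ] := affine_plane_td q_gt1 plane.
have [N HN] := td_large_sub q_gt1 tdQ; exists N => n /HN[G [B [e [cG tdB sub]]]].
case: q q_gt1 {plane HN} BQ tdQ B e tdB sub => // q q_gt1 BQ tdQ B e tdB sub.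
have [P' [c [S [oac subS]]]] := oa_of_td (ltn0Sn q) tdB tdQ sub.
by exists P', G, c, S.
Qed.

End OrthogonalArrays.

(** * Matrices and spectra *)

Section FinTypeMatrix.
Variable F : comNzRingType.

Definition fmx (V W : finType) (f : V -> W -> F) : 'M[F]_(#|V|, #|W|) :=
  \matrix_(i, j) f (enum_val i) (enum_val j).

Lemma fmxE (V W : finType) (f g : V -> W -> F) : fmx f = fmx g -> f =2 g.
Proof.
move=> /matrixP e x y; have := e (enum_rank x) (enum_rank y).
by rewrite !mxE !enum_rankK.
Qed.

Lemma eq_fmx (V W : finType) (f g : V -> W -> F) : f =2 g -> fmx f = fmx g.
Proof. by move=> e; apply/matrixP => i j; rewrite !mxE. Qed.

Lemma mul_fmx (U V W : finType) (f : U -> V -> F) (g : V -> W -> F) :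
  fmx f *m fmx g = fmx (fun x z => \sum_y f x y * g y z).
Proof.
apply/matrixP => i k; rewrite !mxE.
under eq_bigr do rewrite !mxE.
by rewrite -(big_enum_val (A := V) (fun y => f (enum_val i) y * g y (enum_val k))).
Qed.

Lemma tr_fmx (V W : finType) (f : V -> W -> F) :
  (fmx f)^T = fmx (fun x y => f y x).
Proof. by apply/matrixP => i j; rewrite !mxE. Qed.

Lemma scalar_fmx (V : finType) (a : F) :
  a%:M = fmx (fun x y : V => a * (x == y)%:R).
Proof.
by apply/matrixP => i j; rewrite !mxE (inj_eq enum_val_inj) mulr_natr.
Qed.

Lemma const_fmx (V W : finType) (a : F) : const_mx a = fmx (fun (x : V) (y : W) => a).
Proof. by apply/matrixP => i j; rewrite !mxE. Qed.

Lemma add_fmx (V W : finType) (f g : V -> W -> F) :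
  fmx f + fmx g = fmx (fun x y => f x y + g x y).
Proof. by apply/matrixP => i j; rewrite !mxE. Qed.

Lemma scale_fmx (V W : finType) (a : F) (f : V -> W -> F) :
  a *: fmx f = fmx (fun x y => a * f x y).
Proof. by apply/matrixP => i j; rewrite !mxE. Qed.

End FinTypeMatrix.

(** * Spectra under shifts and exchange of factors *)

Section HasSpectrum.
Variable F : fieldType.

(** Unlike [spectrum] it makes sense over any field and names an explicit list, which can be carried
    along matrix identities. *)
Definition has_spectrum (n : nat) (M : 'M[F]_n) (s : seq F) : Prop :=
  char_poly M = \prod_(a <- s) ('X - a%:P).

Lemma has_spectrum_size (n : nat) (M : 'M[F]_n) (s : seq F) :
  has_spectrum M s -> size s = n.
Proof.
by move=> e; have := size_char_poly M; rewrite e size_prod_XsubC => -[].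
Qed.

Lemma has_spectrum_shift (n : nat) (M : 'M[F]_n) (s : seq F) (c : F) :
  has_spectrum M s -> has_spectrum (M + c%:M) [seq a + c | a <- s].
Proof.
move=> e; rewrite /has_spectrum big_map.
have -> : char_poly (M + c%:M) = char_poly M \Po ('X - c%:P).
  rewrite /char_poly -det_map_mx; congr (\det _); apply/matrixP => i j.
  rewrite !mxE; case: (i == j); rewrite ?mulr1n ?mulr0n.
    by rewrite rmorphB /= comp_polyX comp_polyC rmorphD /=; ring.
  by rewrite addr0 !sub0r rmorphN /= comp_polyC.
rewrite e rmorph_prod; apply: eq_bigr => a _.
by rewrite rmorphB /= comp_polyX comp_polyC rmorphD /=; ring.
Qed.

(** Sylvester's identity: the block [b] of [L] is cleared once by a triangular factor on the right
    and once by one on the left; compare determinants. *)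
Lemma char_poly_mulC (m n : nat) (A : 'M[F]_(m, n)) (B : 'M[F]_(n, m)) :
  'X^n * char_poly (A *m B) = 'X^m * char_poly (B *m A).
Proof.
pose a := map_mx polyC A; pose b := map_mx polyC B.
pose L : 'M[{poly F}]_(m + n) := block_mx 'X%:M a b 1%:M.
have d1 : \det L = char_poly (A *m B).
  transitivity (\det (L *m block_mx 1%:M 0 (- b) 1%:M)).
    by rewrite det_mulmx det_lblock !det1 !mulr1.
  rewrite mulmx_block !mulmx0 !mulmx1 !mul1mx add0r mulmxN subrr add0r.
  by rewrite det_ublock det1 mulr1 /char_poly /char_poly_mx map_mxM.
have d2 : 'X^n * \det L = 'X^m * char_poly (B *m A).
  transitivity (\det (block_mx 1%:M 0 (- b) ('X%:M) *m L)).
    by rewrite det_mulmx det_lblock det1 det_scalar mul1r.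
  rewrite mulmx_block !mul0mx !mul1mx !mulmx1 !addr0 mul_mx_scalar.
  rewrite mul_scalar_mx scalerN addNr det_ublock det_scalar.
  congr (_ * \det _); rewrite mulNmx /char_poly_mx map_mxM addrC.
  by [].
by rewrite -d1 d2.
Qed.

Lemma has_spectrum_mulC (m n k : nat) (A : 'M[F]_(m, n)) (B : 'M[F]_(n, m))
    (s : seq F) : (m <= n + k)%N ->
  has_spectrum (A *m B) (s ++ nseq k 0) ->
  has_spectrum (B *m A) (s ++ nseq (n - (m - k)) 0).
Proof.
move=> le_n e; have := char_poly_mulC A B; rewrite e.
have sz := has_spectrum_size e; rewrite size_cat size_nseq in sz.
have X0 l : \prod_(a <- nseq l (0 : F)) ('X - a%:P) = 'X^l.
  by rewrite big_nseq subr0 iter_mulr mulr1.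
rewrite /has_spectrum !big_cat /= !X0 => h.
have Xm : 'X^m != 0 :> {poly F} by rewrite expf_neq0 ?polyX_eq0.
apply: (mulfI Xm); rewrite -h mulrCA [RHS]mulrCA; congr (_ * _).
rewrite -!exprD; congr ('X^_); lia.
Qed.

End HasSpectrum.

Lemma sum_delta_r (F : pzRingType) (V : finType) (f : V -> F) (y : V) :
  \sum_z f z * (z == y)%:R = f y.
Proof.
rewrite (bigD1 y) //= eqxx mulr1 big1 ?addr0 // => z /negbTE->.
by rewrite mulr0.
Qed.

Lemma sum_delta_l (F : pzRingType) (V : finType) (f : V -> F) (y : V) :
  \sum_z (y == z)%:R * f z = f y.
Proof.
rewrite (bigD1 y) //= eqxx mul1r big1 ?addr0 // => z; rewrite eq_sym => /negbTE->.
by rewrite mul0r.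
Qed.

Lemma sum_delta (F : pzRingType) (V : finType) (y : V) :
  \sum_z (y == z)%:R = 1 :> F.
Proof.
rewrite -[RHS](sum_delta_l (fun=> 1 : F) y).
by apply: eq_bigr => z _; rewrite mulr1.
Qed.

Lemma has_spectrum_perm (F : fieldType) (n : nat) (M : 'M[F]_n) (s t : seq F) :
  perm_eq s t -> has_spectrum M s -> has_spectrum M t.
Proof. by move=> st; rewrite /has_spectrum (perm_big _ st). Qed.

(** * Matrix identities and spectrum of a net *)

Section NetSpectrum.
Variables (F : numFieldType) (q : nat) (P G : finType) (c : 'I_q.+1 -> P -> G).
Hypotheses (q_gt0 : (0 < q)%N) (oac : oa c).

Let N : F := #|G|%:R.

Lemma other_class (i : 'I_q.+1) : exists j, i != j.
Proof.
exists (if i == ord0 then ord_max else ord0); case: (eqVneq i ord0) => [->|] //=.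
by rewrite -val_eqE /= eq_sym -lt0n.
Qed.

Lemma sum_meet (i j : 'I_q.+1) (a b : G) : i != j ->
  \sum_x (c i x == a)%:R * (c j x == b)%:R = 1 :> F.
Proof.
move=> neq; have [x xi xj] := oac.1 i j a b neq.
rewrite (bigD1 x) //= xi xj !eqxx mulr1 big1 ?addr0 // => y neqy.
case: eqP => [yi|]; case: eqP => [yj|]; rewrite ?mulr0 ?mul0r //.
by case/eqP: neqy; apply: (oac.2 i j) => //; rewrite ?xi ?xj.
Qed.

Lemma sum_line (i : 'I_q.+1) (a : G) : \sum_x (c i x == a)%:R = N.
Proof.
have [j neq] := other_class i.
transitivity (\sum_(b : G) \sum_x (c i x == a)%:R * (c j x == b)%:R : F).
  rewrite exchange_big /=; apply: eq_bigr => x _.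
  by rewrite -mulr_sumr sum_delta mulr1.
under eq_bigr do rewrite sum_meet //.
by rewrite sumr_const.
Qed.

Lemma sum_line2 (i j : 'I_q.+1) (a b : G) :
  \sum_x (c i x == a)%:R * (c j x == b)%:R =
  N * (((i, a) : 'I_q.+1 * G) == (j, b))%:R + 1 - (i == j)%:R :> F.
Proof.
rewrite xpair_eqE; have [<-|neq] := eqVneq i j; last first.
  by rewrite sum_meet //= mulr0 add0r subr0.
rewrite addrK; have [<-|neq] := eqVneq a b; last first.
  rewrite mulr0 big1 // => x _; case: eqP => [->|]; rewrite ?mul0r //.
  by rewrite (negbTE neq) mulr0.
rewrite mulr1 -(sum_line i a); apply: eq_bigr => x _.
by case: (c i x == a); rewrite ?mulr1 ?mulr0.
Qed.

Lemma card_oa : #|P| = (#|G| ^ 2)%N.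
Proof.
have neq : ord0 != ord_max :> 'I_q.+1 by rewrite -val_eqE /= eq_sym -lt0n.
rewrite -[(_ ^ 2)%N]/(#|G| * #|G|)%N -card_prod.
rewrite -(card_imset (f := fun x => (c ord0 x, c ord_max x))); last first.
  by move=> x y [e0 e1]; apply: (oac.2 ord0 ord_max).
rewrite -cardsT; apply: eq_card => -[a b]; rewrite inE; apply/imsetP.
by have [x <- <-] := oac.1 ord0 ord_max a b neq; exists x.
Qed.

Definition coll (x y : P) : bool := [exists i, c i x == c i y].

(** The point-line incidence matrix times its transpose; [coll] is the matrix X of the overview. *)
Definition hits (x y : P) : F := \sum_i (c i x == c i y)%:R.

Lemma hitsE (x y : P) : hits x y = (coll x y)%:R + q%:R * (x == y)%:R.
Proof.
rewrite /hits /coll; have [<-|neq] := eqVneq x y.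
  under eq_bigr do rewrite eqxx.
  rewrite sumr_const card_ord; have -> : [exists i : 'I_q.+1, c i x == c i x].
    by apply/existsP; exists ord0.
  by rewrite mulr1 -natr1 addrC.
rewrite mulr0 addr0; case: existsP => [[i ei]|none].
  rewrite (bigD1 i) //= ei big1 ?addr0 // => j neqj.
  case: eqP => // ej; case/eqP: neq; apply: (oac.2 i j); rewrite 1?eq_sym //.
  exact/eqP.
rewrite big1 // => i _; case: eqP => // ei; case: none; exists i; exact/eqP.
Qed.

(** A line through [x] and a line through [y] of another class meet once, which gives [q (q + 1)];
    within a class only equal lines contribute, [N] points each. *)
Lemma sum_hits2 (x y : P) :
  \sum_z hits x z * hits z y = N * hits x y + q%:R * (q%:R + 1).
Proof.
transitivity (\sum_i \sum_j (N * (((i, c i x) : 'I_q.+1 * G) == (j, c j y))%:R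
    + 1 - (i == j)%:R) : F).
  under eq_bigr do rewrite mulr_suml.
  rewrite exchange_big; apply: eq_bigr => i _ /=.
  under eq_bigr do rewrite mulr_sumr.
  rewrite exchange_big; apply: eq_bigr => j _ /=.
  by rewrite -sum_line2; apply: eq_bigr => z _; rewrite (eq_sym (c i x)).
transitivity (\sum_(i < q.+1) (N * (c i x == c i y)%:R + q%:R) : F); last first.
  by rewrite big_split -mulr_sumr sumr_const card_ord -[_ *+ q.+1]mulr_natr -natr1.
apply: eq_bigr => i _; rewrite sumrB big_split /= sumr_const card_ord -mulr_sumr.
rewrite sum_delta -[q.+1%:R]natr1 addrA addrK; congr (N * _ + _).
rewrite -[RHS](sum_delta_l (fun j => (c i x == c j y)%:R) i).
by apply: eq_bigr => j _; rewrite xpair_eqE; case: (i == j); rewrite ?mul1r ?mul0r.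
Qed.

Lemma sum_coll2 (x y : P) :
  \sum_z (coll x z)%:R * (coll z y)%:R =
  (N - 2 * q%:R) * (coll x y)%:R + q%:R * (N - q%:R) * (x == y)%:R
    + q%:R * (q%:R + 1) :> F.
Proof.
have E u v : (coll u v)%:R = hits u v - q%:R * (u == v)%:R by rewrite hitsE addrK.
transitivity (\sum_z (hits x z * hits z y - q%:R * (hits x z * (z == y)%:R)
   - q%:R * ((x == z)%:R * hits z y)
   + q%:R * q%:R * ((x == z)%:R * (z == y)%:R)) : F).
  by apply: eq_bigr => z _; rewrite !E; ring.
rewrite big_split /= !sumrB -!mulr_sumr sum_hits2 sum_delta_r !sum_delta_l hitsE.
ring.
Qed.

Section Extension.
Variables (V : finType) (E : V -> P -> F).
Hypothesis E_orth : forall y z, \sum_u E u y * E u z = 2 * (y == z)%:R.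

Definition ext_mx (u v : V) : F := \sum_y (\sum_x E u x * (coll x y)%:R) * E v y.

(** No eigenvectors are used: from a matrix of order 1 the spectrum is moved by shifts and by
    exchanging [A *m B] with [B *m A], passing from classes to lines, points and finally
    vertices. *)
Lemma net_ext_spectrum : (q < #|G|)%N -> (#|P| <= #|V|)%N ->
  has_spectrum (fmx ext_mx + (- 1)%:M)
    (2 * (q%:R + 1) * (N - 1) + 1
     :: nseq ((#|G| - 1) * (q + 1)) (2 * N - 2 * q%:R - 1)
     ++ nseq ((#|G| - 1) * (#|G| - q)) (- 2 * q%:R - 1)
     ++ nseq (#|V| - #|P|) (- 1)).
Proof.
move=> lt_qG le_PV.
have cG : #|P| = (#|G| * #|G|)%N by rewrite card_oa.
set K := (q%:R + 1 : F).
have EK : #|'I_q.+1|%:R = K by rewrite card_ord -natr1.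
pose l : nat := #|{: 'I_q.+1 * G}|.
have lE : l = (q.+1 * #|G|)%N by rewrite /l card_prod card_ord.
pose u1 : 'M[F]_(#|'I_q.+1|, 1) := const_mx 1.
pose u2 : 'M[F]_(1, #|'I_q.+1|) := const_mx (2 * N).
have s1 : has_spectrum (u1 *m u2)
    ([:: 2 * N * K] ++ nseq q 0).
  have Eq : q = (#|'I_q.+1| - (1 - 0))%N by rewrite card_ord subn1.
  rewrite [X in nseq X _]Eq.
  apply: (has_spectrum_mulC (k := 0)); first by rewrite card_ord.
  rewrite /has_spectrum cats0 big_seq1 /char_poly det_mx11 !mxE eqxx mulr1n.
  congr (_ - _%:P); under eq_bigr do rewrite !mxE mulr1.
  by rewrite sumr_const [X in _ *+ X]card_ord -[_ *+ _]mulr_natr EK.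
have s2 := has_spectrum_shift (- (2 * N)) s1.
pose f (ia : 'I_q.+1 * G) (j : 'I_q.+1) : F := (ia.1 == j)%:R.
pose w (i j : 'I_q.+1) : F := 2 * (1 - (i == j)%:R).
have sum_f (g : 'I_q.+1 -> F) ia : \sum_j f ia j * g j = g ia.1.
  exact: sum_delta_l.
(* [f] is the incidence of lines with classes and f^T f = N I, so f w f^T has the spectrum of N w =
   2 N (J - I) together with zeros. *)
have s3 : has_spectrum ((fmx f *m fmx w) *m (fmx f)^T)
    ((2 * N * K - 2 * N :: nseq q (- (2 * N))) ++ nseq (l - q.+1) 0).
  have -> : (l - q.+1 = l - (#|'I_q.+1| - 0))%N by rewrite card_ord subn0.
  apply: has_spectrum_mulC; first by rewrite card_ord -/l lE; nia.
  rewrite cats0; move: s2; rewrite /= map_nseq add0r.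
  suff <- : (fmx f)^T *m (fmx f *m fmx w) = u1 *m u2 + (- (2 * N))%:M.
    by [].
  have -> : u1 *m u2 = const_mx (2 * N)
      :> 'M[F]_#|'I_q.+1|.
    by apply/matrixP => i j; rewrite !mxE big_ord1 !mxE mul1r.
  rewrite scalar_fmx const_fmx tr_fmx !mul_fmx add_fmx; apply: eq_fmx => i j.
  under eq_bigr do rewrite sum_f.
  rewrite -(pair_bigA _ (fun i' (_ : G) => (i' == i)%:R * w i' j)) /=.
  under eq_bigr do rewrite sumr_const -[_ *+ _]mulr_natl mulrCA.
  rewrite (bigD1 i) //= eqxx mul1r big1 ?addr0 => [|i' /negbTE->]; last first.
    by rewrite mul0r.
  by rewrite /w /N; ring.
pose h (x : P) (ia : 'I_q.+1 * G) : F := (c ia.1 x == ia.2)%:R.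
pose g ia x : F := 2 * h x ia.
(* Twice the matrix of intersection sizes of lines: [N] on the diagonal, 0 for parallel lines, 1
   otherwise. *)
have s4 : has_spectrum (fmx g *m fmx h)
    ((2 * N * K :: nseq (l - q.+1) (2 * N)) ++ nseq q 0).
  have := has_spectrum_shift (2 * N) s3.
  rewrite map_cat /= !map_nseq add0r subrK addNr.
  suff -> : fmx f *m fmx w *m (fmx f)^T + (2 * N)%:M = fmx g *m fmx h.
    by apply: has_spectrum_perm; rewrite /= perm_cons perm_catC.
  rewrite scalar_fmx tr_fmx !mul_fmx add_fmx; apply: eq_fmx => -[i a] [j b].
  under eq_bigr do rewrite sum_f mulrC.
  under [RHS]eq_bigr do rewrite /g -mulrA.
  by rewrite sum_f -mulr_sumr sum_line2 /w /=; ring.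
have s5 : has_spectrum (fmx h *m fmx g)
    ((2 * N * K :: nseq (l - q.+1) (2 * N)) ++ nseq (#|P| - (l - q)) 0).
  by apply: has_spectrum_mulC s4; rewrite -/l lE cG; nia.
(* 2 [hits] - 2 q I = 2 X, and 2 X = E^T (E X) by orthogonality, ready for the last exchange. *)
have s6 : has_spectrum (fmx (fun x u => E u x)
      *m (fmx E *m fmx (fun x y => (coll x y)%:R)))
    ((2 * N * K - 2 * q%:R :: nseq (l - q.+1) (2 * N - 2 * q%:R)
      ++ nseq (#|P| - (l - q)) (- (2 * q%:R))) ++ nseq 0 0).
  have := has_spectrum_shift (- (2 * q%:R)) s5.
  rewrite cats0 /= map_cat !map_nseq add0r.
  congr has_spectrum.
  rewrite scalar_fmx !mul_fmx add_fmx; apply: eq_fmx => x y.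
  transitivity (2 * hits x y - 2 * q%:R * (x == y)%:R).
    congr (_ + _); last by rewrite mulNr.
    rewrite /hits mulr_sumr.
    rewrite -(pair_bigA _ (fun i a => h x (i, a) * g (i, a) y)) /=.
    apply: eq_bigr => i _; rewrite /g /h /=.
    rewrite -[in RHS](sum_delta_l (fun a => 2 * (a == c i y)%:R) (c i x)).
    by apply: eq_bigr => a _; rewrite (eq_sym a).
  under [RHS]eq_bigr do rewrite mulr_sumr.
  rewrite exchange_big /=.
  under [RHS]eq_bigr do under eq_bigr do rewrite mulrA.
  under [RHS]eq_bigr do rewrite -mulr_suml E_orth -mulrA.
  by rewrite -mulr_sumr sum_delta_l hitsE; ring.
have := has_spectrum_shift (- 1) (has_spectrum_mulC _ s6).
rewrite !mul_fmx subn0 /= !map_cat !map_nseq add0r => H.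
have {}H := H (leq_trans le_PV (leq_addr _ _)).
move: H; congr has_spectrum; last first.
  rewrite -catA /K; congr (_ :: nseq _ _ ++ nseq _ _ ++ _); try ring.
    by rewrite lE mulnBl mul1n addn1 (mulnC q.+1).
  move: lt_qG; rewrite lE cG; move: #|G| => m lt_qm.
  rewrite -(subnK lt_qm); move: (m - q.+1)%N => d.
  by rewrite mulnDr mulnDl; nia.
Qed.

End Extension.
End NetSpectrum.

(** * Common neighbours and coherent rank *)

Section Graphs.

Lemma adjmx_fmx (F : comNzRingType) (G : sgraph) :
  adjmx F G = fmx (fun x y : G => (adj x y)%:R).
Proof. by apply/matrixP => i j; rewrite !mxE. Qed.

Lemma common_nbrs_sum (F : pzRingType) (G : sgraph) (x y : G) :
  (common_nbrs x y)%:R = \sum_z (adj x z)%:R * (adj z y)%:R :> F.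
Proof.
rewrite /common_nbrs -sum1_card natr_sum big_mkcond /=; apply: eq_bigr => z _.
rewrite !inE (adj_sym y); case: (adj x z); case: (adj z y);
by rewrite ?mulr1 ?mulr0.
Qed.

Lemma has_spectrum_adjmx (F : closedFieldType) (G : sgraph) (s : seq F) :
  has_spectrum (adjmx F G) s -> perm_eq (spectrum (adjmx F G)) s.
Proof. by rewrite /has_spectrum char_poly_spectrum => /prod_XsubC_eq. Qed.

(** Vandermonde: a linear relation between the entrywise powers of [z] below [d] is a polynomial of
    degree below [d] with [d] distinct roots. *)
Lemma hadamard_dim (F : fieldType) (V : finType) (W : {vspace 'M[F]_#|V|})
    (z : V -> V -> F) (s : seq F) :
    const_mx 1 \in W -> {in W &, forall M N, map2_mx *%R M N \in W} ->
    fmx z \in W -> uniq s ->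
    (forall a, a \in s -> exists x y, z x y = a) ->
  (size s <= \dim W)%N.
Proof.
move=> WJ WH Wz us att; set d := size s.
pose X := [tuple fmx (fun x y => z x y ^+ i) | i < d].
have XE (i : 'I_d) : X`_i = fmx (fun x y => z x y ^+ i) by rewrite -tnth_nth tnth_mktuple.
have WX i : fmx (fun x y => z x y ^+ i) \in W.
  elim: i => [|i IHi]; first by rewrite const_fmx in WJ.
  have := WH _ _ Wz IHi; congr (_ \in W).
  by apply/matrixP => a b; rewrite !mxE exprS.
have fX : free X.
  apply/freeP => k Ek; pose p := \poly_(i < d) (if insub i is Some j then k j else 0).
  suff p0 : p = 0.
    move=> i; have := congr1 (fun r : {poly F} => r`_i) p0.
    by rewrite coef_poly ltn_ord valK coef0.
  apply/eqP; apply: contraTT isT => pn0.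
  have := max_poly_roots pn0 _ us; rewrite ltnNge size_poly => -> //.
  apply/allP => a /att[x [y <-]]; rewrite /root horner_poly.
  have := congr1 (fun M : 'M[F]_#|V| => M (enum_rank x) (enum_rank y)) Ek.
  rewrite summxE !mxE => E; rewrite -[X in _ == X]E; apply/eqP.
  by apply: eq_bigr => i _; rewrite XE !mxE !enum_rankK valK.
have /eqnP <- : size X == d by rewrite size_tuple.
rewrite -(eqnP fX); apply: dimvS; apply/span_subvP => M /tnthP[i ->].
by rewrite tnth_mktuple.
Qed.

Lemma coherent_rank_ge (F : numFieldType) (G : sgraph) (x0 y0 : G) :
  x0 != y0 -> ~~ adj x0 y0 -> (lambda_level G + 2 <= coherent_rank F G)%N.
Proof.
move=> neq nadj; rewrite /coherent_rank.
have [[[W1 WJ WA] [WM WT WH]] _] := coherent_closureP F G.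
set W := coherent_closure F G in W1 WJ WA WM WT WH *.
(* On edges this is the number of common neighbours; it is -1 on the diagonal and -2 elsewhere,
   values that no number of common neighbours can equal. *)
pose z (x y : G) : F := (adj x y)%:R * (common_nbrs x y)%:R + (x == y)%:R
   - 2 + 2 * (adj x y)%:R.
rewrite /lambda_level; set L := undup _.
pose s : seq F := - 1 :: - 2 :: [seq m%:R | m <- L].
have -> : (size L + 2)%N = size s.
  by rewrite /= size_map addn2.
have negn (a : nat) (m : nat) : - a.+1%:R <> m%:R :> F.
  move=> e; have : 0 <= - a.+1%:R :> F by rewrite e ler0n.
  by rewrite oppr_ge0 lern0.
apply: (hadamard_dim (z := z)) => //.
- have -> : fmx z = map2_mx *%R (adjmx F G) (adjmx F G *m adjmx F G) + 1%:M
      + (- 2 : F) *: const_mx 1 + (2 : F) *: adjmx F G.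
    rewrite adjmx_fmx mul_fmx; apply/matrixP => i j; rewrite !mxE.
    by rewrite -common_nbrs_sum /z (inj_eq enum_val_inj) mulr1.
  by rewrite !memvD ?memvZ ?WH ?WM.
- rewrite /= inE negb_or -!andbA; apply/and4P; split.
  + by rewrite eqr_opp (eqr_nat F 1 2).
  + by apply/mapP => -[m _ /(negn 0%N)].
  + by apply/mapP => -[m _ /(negn 1%N)].
  + rewrite map_inj_uniq ?undup_uniq // => a b /eqP; rewrite eqr_nat => /eqP //.
move=> a; rewrite !inE => /or3P[/eqP->|/eqP->|/mapP[m]].
- by exists x0, x0; rewrite /z adj_irr eqxx /=; ring.
- by exists x0, y0; rewrite /z (negbTE nadj) (negbTE neq) /=; ring.
rewrite mem_undup => /mapP[[x y]]; rewrite mem_enum inE /= => xy -> ->.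
exists x, y; rewrite /z xy; have [E|_] := eqVneq x y; first by rewrite E adj_irr in xy.
by rewrite /=; ring.
Qed.

Variables (F : comNzRingType) (G : sgraph).

Lemma common_nbrs_reflexive (x y : G) :
  \sum_z ((x == z) || adj x z)%:R * ((z == y) || adj z y)%:R =
  (common_nbrs x y)%:R + 2 * (adj x y)%:R + (x == y)%:R :> F.
Proof.
have E (u v : G) : ((u == v) || adj u v)%:R = (u == v)%:R + (adj u v)%:R :> F.
  by case: eqVneq => [->|]; rewrite ?adj_irr ?addr0 ?add0r.
under eq_bigr do rewrite !E mulrDl !mulrDr.
rewrite !big_split /= -common_nbrs_sum !sum_delta_l sum_delta_r.
ring.
Qed.

End Graphs.

Section ExtensionSquare.
Variables (F : numFieldType) (q : nat) (P G : finType) (c : 'I_q.+1 -> P -> G).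
Hypotheses (q_gt0 : (0 < q)%N) (oac : oa c).
Variables (V : finType) (E : V -> P -> F).
Hypothesis E_orth : forall y z, \sum_u E u y * E u z = 2 * (y == z)%:R.
Hypothesis E_sum : forall u, \sum_y E u y = 1.

Let N : F := #|G|%:R.

(** E^T E = 2 I turns the square of E X E^T into 2 E X^2 E^T, where [sum_coll2] expands X^2; since
    the rows of E sum to 1, E J E^T = J. *)
Lemma ext_mx_sq (u v : V) :
  \sum_w ext_mx c E u w * ext_mx c E w v =
  2 * (N - 2 * q%:R) * ext_mx c E u v + 2 * q%:R * (N - q%:R) * (\sum_y E u y * E v y)
    + 2 * q%:R * (q%:R + 1).
Proof.
pose C := fmx (fun x y => (coll c x y)%:R : F).
pose EV := fmx E.
have EE : EV^T *m EV = 2%:M.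
  by rewrite tr_fmx mul_fmx scalar_fmx; apply: eq_fmx => y z; rewrite E_orth.
have CC : C *m C = (N - 2 * q%:R) *: C + (q%:R * (N - q%:R))%:M
    + const_mx (q%:R * (q%:R + 1)).
  rewrite mul_fmx scale_fmx scalar_fmx const_fmx !add_fmx; apply: eq_fmx => x y.
  exact: sum_coll2.
have extE : fmx (ext_mx c E) = EV *m C *m EV^T by rewrite tr_fmx !mul_fmx.
pose rhs u v := 2 * (N - 2 * q%:R) * ext_mx c E u v
  + 2 * q%:R * (N - q%:R) * (\sum_y E u y * E v y) + 2 * q%:R * (q%:R + 1).
suff eqM : fmx (fun u v => \sum_w ext_mx c E u w * ext_mx c E w v) = fmx rhs.
  exact: (fmxE eqM u v).
rewrite -mul_fmx extE.
transitivity (2 *: (EV *m (C *m C) *m EV^T)).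
  rewrite -!mulmxA (mulmxA EV^T) EE mul_scalar_mx !linearZ /=.
  by rewrite !mulmxA.
have EJ : EV *m const_mx (q%:R * (q%:R + 1)) *m EV^T =
    const_mx (q%:R * (q%:R + 1)) :> 'M_#|V|.
  rewrite !const_fmx tr_fmx !mul_fmx; apply: eq_fmx => x y.
  under eq_bigr do rewrite -mulr_suml E_sum mul1r.
  by rewrite -mulr_sumr E_sum mulr1.
rewrite CC !mulmxDr !mulmxDl EJ -scalemxAr -scalemxAl -extE mul_mx_scalar -scalemxAl.
rewrite tr_fmx mul_fmx !scale_fmx const_fmx !add_fmx !scale_fmx.
by apply: eq_fmx => x y; rewrite /rhs; ring.
Qed.

End ExtensionSquare.

(** * From coordinates back to nets *)

Section NetOfArray.
Variables (q : nat) (P G : finType) (c : 'I_q.+1 -> P -> G).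
Hypotheses (q_gt0 : (0 < q)%N) (oac : oa c) (G_gt1 : (1 < #|G|)%N).

Definition fiber (ia : 'I_q.+1 * G) : {set P} := [set x | c ia.1 x == ia.2].

Definition fibers : {set {set P}} := [set fiber ia | ia in [set: 'I_q.+1 * G]].

Lemma card_fiber (ia : 'I_q.+1 * G) : #|fiber ia| = #|G|.
Proof.
apply/eqP; rewrite -(eqr_nat rat) -(sum_line rat q_gt0 oac ia.1 ia.2).
rewrite -sum1_card natr_sum big_mkcond /=; apply/eqP; apply: eq_bigr => x _.
by rewrite inE; case: eqP.
Qed.

Lemma fiber_class_inj (i j : 'I_q.+1) (a b : G) :
  fiber (i, a) = fiber (j, b) -> i = j.
Proof.
move=> e; apply/eqP/negPn/negP => neq.
have [b' nb] : exists b', b' != b.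
  by apply/existsP; apply: contraTT G_gt1; rewrite negb_exists -leqNgt;
    move/forallP => H; apply/card_le1_eqP => y z _ _;
    rewrite (eqP (negPn (H y))) (eqP (negPn (H z))).
have [x xi xj] := oac.1 i j a b' neq.
have : x \in fiber (j, b) by rewrite -e inE /= xi.
by rewrite inE /= xj (negbTE nb).
Qed.

Lemma net_of_oa : net q.+1 #|G| fibers.
Proof.
have Gp : #|G|.-1.+1 = #|G| by rewrite prednK // ltnW.
split; last first.
  move=> p L /imsetP[[i a] _ ->]; rewrite inE /= => ne.
  exists (fiber (i, c i p)); split.
    split; [by apply/imsetP; exists (i, c i p) | by rewrite inE /= | ].
    rewrite disjoint_subset; apply/subsetP => x; rewrite !inE /= => /eqP->.
    exact: ne.
  move=> M [/imsetP[[j b] _ ->]]; rewrite inE /= => /eqP <- dis.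
  have [-> //|neq] := eqVneq i j.
  have [x xi xj] := oac.1 i j a (c j p) neq.
  by have /pred0P/(_ x) := dis; rewrite /= !inE /= xi xj !eqxx.
split=> /=; [split| |].
- rewrite (card_oa q_gt0 oac) expn_gt0; apply/orP; left; exact: ltnW.
- by move=> L /imsetP[ia _ ->]; rewrite card_fiber.
- move=> x y neq; apply/card_le1_eqP => L M; rewrite !inE.
  case/andP=> /imsetP[[i a] _ ->] /andP[]; rewrite !inE /= => /eqP xi /eqP yi.
  case/andP=> /imsetP[[j b] _ ->] /andP[]; rewrite !inE /= => /eqP xj /eqP yj.
  have [Eij|nij] := eqVneq i j; first by subst j; congr (fiber (_, _)); rewrite -xi -xj.
  by case/eqP: neq; apply: (oac.2 i j) => //; rewrite ?xi ?xj.
- move=> x; rewrite -[RHS]card_ord -(card_imset (f := fun i => fiber (i, c i x))).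
    apply: eq_card => L; rewrite !inE; apply/andP/imsetP.
      by move=> [/imsetP[[i a] _ ->]]; rewrite inE /= => /eqP <-; exists i.
    move=> [i _ ->]; rewrite inE /= eqxx; split=> //.
    by apply/imsetP; exists (i, c i x).
  by move=> i j /fiber_class_inj.
- by move=> L /imsetP[ia _ ->]; rewrite card_fiber Gp.
Qed.

Lemma collinear_fibers (x y : P) : collinear fibers x y = (x != y) && coll c x y.
Proof.
rewrite /collinear; congr (_ && _); apply/exists_inP/existsP.
  move=> [L /imsetP[[i a] _ ->]]; rewrite !inE /= => /andP[/eqP xa /eqP ya].
  by exists i; rewrite xa ya.
move=> [i /eqP e]; exists (fiber (i, c i x)); last by rewrite !inE /= e eqxx.
by apply/imsetP; exists (i, c i x).
Qed.

Lemma clique_ext_adj_fibers (u v : P * 'I_2) :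
  (u == v) || @adj (clique_ext 2 (point_graph fibers)) u v = coll c u.1 v.1.
Proof.
rewrite /= /clique_ext_adj /= collinear_fibers; case: u v => [x a] [y b] /=.
rewrite xpair_eqE; have [<-|neq] /= := eqVneq x y; last by [].
rewrite orbF orbN; apply/esym/existsP; exists ord0; exact: eqxx.
Qed.

End NetOfArray.

(** * The twisted graph *)

Section Twist.
Variables (q : nat) (P G : finType) (c : 'I_q.+1 -> P -> G).
Variables (S : {set P}) (sg : 'I_q.+1 -> G -> G).
Hypotheses (q_gt0 : (0 < q)%N) (oac : oa c) (subS : oa_sub q c S).
(** Together the three hypotheses say that [sg i] permutes the labels of those lines of class [i]
    that carry a point of [S]. *)
Hypothesis sg_into : forall i s, s \in S ->
  exists2 r, r \in S & sg i (c i s) = c i r.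
Hypothesis sg_onto : forall i s, s \in S ->
  exists2 r, r \in S & sg i (c i r) = c i s.
Hypothesis sg_inj : forall i r s, r \in S -> s \in S ->
  sg i (c i r) = sg i (c i s) -> c i r = c i s.

Definition twisted (u : P * 'I_2) : bool := (u.1 \in S) && (u.2 == ord_max).

Definition label (i : 'I_q.+1) (u : P * 'I_2) : G :=
  if twisted u then sg i (c i u.1) else c i u.1.

(** Reflexive by design: it represents A + I, the matrix that factors as E X E^T. *)
Definition tls_rel (u v : P * 'I_2) : bool :=
  (u.1 \in S) && (v.1 \in S) || [exists i, label i u == label i v].

Lemma tls_rel_sym : symmetric tls_rel.
Proof.
move=> u v; rewrite /tls_rel andbC; congr (_ || _).
by apply: eq_existsb => i; rewrite eq_sym.
Qed.

Lemma tls_rel_refl : reflexive tls_rel.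
Proof.
by move=> u; rewrite /tls_rel; apply/orP; right; apply/existsP; exists ord0.
Qed.

Definition tls_adj : rel (P * 'I_2) := fun u v => (u != v) && tls_rel u v.

Lemma tls_adj_sym : symmetric tls_adj.
Proof. by move=> u v; rewrite /tls_adj eq_sym tls_rel_sym. Qed.

Lemma tls_adj_irr : irreflexive tls_adj.
Proof. by move=> u; rewrite /tls_adj eqxx. Qed.

Definition tls : sgraph := SGraph tls_adj_sym tls_adj_irr.

Lemma tls_relE (u v : tls) : (u == v) || adj u v = tls_rel u v.
Proof. by rewrite /= /tls_adj; case: eqVneq => //= ->; rewrite tls_rel_refl. Qed.

(** Lines of different classes that carry points of [S] meet inside [S]. *)
Lemma outside_hit_uniq (i j : 'I_q.+1) (s r y : P) : s \in S -> r \in S ->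
  y \notin S -> c i s = c i y -> c j r = c j y -> i = j.
Proof.
move=> sS rS yS si rj; apply/eqP/negPn/negP => neq.
have [_ /(_ i j s r neq sS rS)[t tS [ti tj]] _] := subS.
by case/negP: yS; rewrite -(oac.2 i j t y neq) ?ti ?tj.
Qed.

Variable F : numFieldType.

Let Q : F := q%:R.

Lemma Q_neq0 : Q != 0.
Proof. by rewrite pnatr_eq0 -lt0n. Qed.

Definition twist_hits (x y : P) : nat := #|[set i | sg i (c i x) == c i y]|.

Lemma twist_hitsE (x y : P) :
  (twist_hits x y)%:R = \sum_i (sg i (c i x) == c i y)%:R :> F.
Proof.
rewrite /twist_hits -sum1_card natr_sum big_mkcond /=; apply: eq_bigr => i _.
by rewrite inE; case: eqP.
Qed.

Definition twist_mx (x y : P) : F := ((twist_hits x y)%:R - 1) / Q.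

Lemma sub_meet (i j : 'I_q.+1) (s s' : P) : i != j -> s \in S -> s' \in S ->
  \sum_(r in S) (c i r == c i s)%:R * (c j r == c j s')%:R = 1 :> F.
Proof.
move=> neq sS s'S; have [_ /(_ i j s s' neq sS s'S)[t tS [ti tj]] _] := subS.
rewrite (bigD1 t) //= ti tj !eqxx mulr1 big1 ?addr0 // => r /andP[rS neqr].
case: eqP => [ri|]; case: eqP => [rj|]; rewrite ?mulr0 ?mul0r //.
by case/eqP: neqr; apply: (oac.2 i j) => //; rewrite ?ti ?tj.
Qed.

Lemma sub_line (i : 'I_q.+1) (s : P) : s \in S ->
  \sum_(r in S) (c i r == c i s)%:R = Q.
Proof.
move=> sS; have [_ _ /(_ i s sS) cardS] := subS.
transitivity (#|[set r in S | c i r == c i s]|%:R : F); last by rewrite cardS.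
rewrite -sum1_card natr_sum big_mkcond [RHS]big_mkcond /=; apply: eq_bigr => r _.
by rewrite inE; case: (r \in S) => //=; case: eqP.
Qed.

Lemma sub_line2 (i j : 'I_q.+1) (s s' : P) : s \in S -> s' \in S ->
  \sum_(r in S) (c i r == c i s)%:R * (c j r == c j s')%:R =
  1 + (i == j)%:R * (Q * (c i s == c j s')%:R - 1).
Proof.
move=> sS s'S; have [<-|neq] := eqVneq i j; last first.
  by rewrite sub_meet // mul0r addr0.
have [e|ne] := eqVneq (c i s) (c i s'); last first.
  rewrite big1 ?mulr0 ?sub0r ?mul1r ?subrr // => r _.
  by case: eqP => [->|]; rewrite ?mul0r // (negbTE ne) mulr0.
rewrite mulr1 mul1r addrC subrK -(sub_line i sS); apply: eq_bigr => r _.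
by rewrite -e; case: eqP; rewrite ?mulr1 ?mulr0.
Qed.

Lemma sub_card : #|S|%:R = Q * Q.
Proof.
have [j neq] := other_class q_gt0 ord0.
have [[s sS] _ _] := subS.
transitivity (\sum_(r in S) \sum_(t in S)
    (c ord0 r == c ord0 t)%:R * (c j t == c j s)%:R : F).
  rewrite -sum1_card natr_sum; apply: eq_bigr => r rS.
  rewrite -[LHS](sub_meet neq rS sS); apply: eq_bigr => t _.
  by rewrite (eq_sym (c ord0 r)).
rewrite exchange_big /=.
under eq_bigr => t tS do rewrite -mulr_suml sub_line //.
by rewrite -mulr_sumr sub_line.
Qed.

Lemma sum_hits_sub (s : P) : s \in S ->
  \sum_(r in S) hits F c s r = Q * (Q + 1).
Proof.
move=> sS; rewrite exchange_big /=.
transitivity (\sum_(i < q.+1) Q); last first.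
  by rewrite sumr_const card_ord -[_ *+ q.+1]mulr_natr -natr1.
apply: eq_bigr => i _; rewrite -(sub_line i sS); apply: eq_bigr => r _.
by rewrite eq_sym.
Qed.

(** Counting: the [q + 1] lines through [s] carry [q (q + 1) - q = q ^ 2] distinct points of [S],
    which is all of [S]. *)
Lemma sub_coll (s r : P) : s \in S -> r \in S -> coll c s r.
Proof.
move=> sS rS.
have : \sum_(t in S) (1 - (coll c s t)%:R) = 0 :> F.
  rewrite sumrB sumr_const sub_card.
  have -> : \sum_(t in S) (coll c s t)%:R =
      \sum_(t in S) hits F c s t - Q * \sum_(t in S) (s == t)%:R.
    rewrite mulr_sumr -sumrB; apply: eq_bigr => t _.
    by rewrite (hitsE _ oac) addrK.
  rewrite sum_hits_sub // (bigD1 s) //= eqxx big1 => [|t /andP[_ /negbTE]].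
    by rewrite /=; ring.
  by rewrite eq_sym => ->.
move/psumr_eq0P => /(_ _ r rS); case: (coll c s r) => // H.
have /eqP : 1 - 0 = 0 :> F.
  by apply: H => t _; case: (coll c s t); rewrite ?subrr ?subr0.
by rewrite subr0 oner_eq0.
Qed.

(** If [a] labels a line carrying points of [S], the permuted lines through [x] from the other [q]
    classes meet it once each inside [S], and that of class [i] in [q] points or none. Subtracting
    the [q] points of the line and dividing by [q] leaves 1 or 0. *)
Lemma twist_mx_line (x : P) (i : 'I_q.+1) (a : G) : x \in S ->
  \sum_(y in S) twist_mx x y * (c i y == a)%:R = (sg i (c i x) == a)%:R.
Proof.
move=> xS; have [[s sS sa]|none] := pselect (exists2 s, s \in S & c i s = a); last first.
  rewrite big1 => [|y yS]; last first.
    by case: eqP => [ya|]; rewrite ?mulr0 //; case: none; exists y.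
  case: eqP => // xa; case: none; have [r rS xr] := sg_into i xS.
  by exists r; rewrite // -xr.
rewrite -sa.
under eq_bigr => y _ do rewrite /twist_mx mulrAC.
rewrite -mulr_suml; apply: (mulIf Q_neq0); rewrite divfK ?Q_neq0 //.
under eq_bigr => y _ do rewrite mulrBl mul1r twist_hitsE mulr_suml.
rewrite sumrB sub_line // exchange_big /=.
transitivity (\sum_j (1 + (j == i)%:R * (Q * (sg i (c i x) == c i s)%:R - 1)) - Q).
  congr (_ - _); apply: eq_bigr => j _; have [r rS jr] := sg_into j xS.
  rewrite jr; under eq_bigr => y _ do rewrite (eq_sym (c j r)).
  rewrite sub_line2 //; case: eqVneq => [E|]; last by rewrite !mul0r.
  by move: jr; rewrite E => ->.
rewrite big_split /= sumr_const card_ord.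
under eq_bigr => j _ do rewrite (eq_sym j).
by rewrite -mulr_suml sum_delta -natr1 /Q; ring.
Qed.

Lemma twist_mx_row_sum (x : P) : x \in S -> \sum_(y in S) twist_mx x y = 1.
Proof.
move=> xS.
transitivity (\sum_a \sum_(y in S) twist_mx x y * (c ord0 y == a)%:R).
  rewrite exchange_big; apply: eq_bigr => y _ /=.
  by rewrite -mulr_sumr sum_delta mulr1.
under eq_bigr => a _ do rewrite twist_mx_line //.
exact: sum_delta.
Qed.

Lemma twist_line2 (i j : 'I_q.+1) (s s' : P) : s \in S -> s' \in S ->
  \sum_(r in S) (sg i (c i r) == c i s)%:R * (sg j (c j r) == c j s')%:R =
  1 + (i == j)%:R * (Q * (c i s == c j s')%:R - 1).
Proof.
move=> sS s'S; have [t tS ti] := sg_onto i sS; have [t' t'S tj] := sg_onto j s'S.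
have -> : (i == j)%:R * (Q * (c i s == c j s')%:R - 1) =
    (i == j)%:R * (Q * (c i t == c j t')%:R - 1).
  have [Eij|] := eqVneq i j; last by rewrite !mul0r.
  subst j; congr (_ * (Q * _%:R - _)); congr nat_of_bool; rewrite -ti -tj.
  by apply/eqP/eqP => [/sg_inj->|->].
rewrite -sub_line2 //; apply: eq_bigr => r rS; congr (_%:R * _%:R); congr nat_of_bool.
  by rewrite -ti; apply/eqP/eqP => [/sg_inj->|->].
by rewrite -tj; apply/eqP/eqP => [/sg_inj->|->].
Qed.

Lemma twist_line (i : 'I_q.+1) (s : P) : s \in S ->
  \sum_(r in S) (sg i (c i r) == c i s)%:R = Q.
Proof.
move=> sS; transitivity
  (\sum_(r in S) (sg i (c i r) == c i s)%:R * (sg i (c i r) == c i s)%:R : F).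
  by apply: eq_bigr => r _; case: eqP; rewrite ?mulr1 ?mulr0.
by rewrite twist_line2 // !eqxx /=; ring.
Qed.

Lemma sum_twist_hits (s : P) : s \in S ->
  \sum_(r in S) (twist_hits r s)%:R = Q * (Q + 1).
Proof.
move=> sS; under eq_bigr => r _ do rewrite twist_hitsE.
rewrite exchange_big /=; under eq_bigr => i _ do rewrite twist_line //.
by rewrite sumr_const card_ord -[_ *+ q.+1]mulr_natr -natr1.
Qed.

Lemma twist_mx_col_sum (y : P) : y \in S -> \sum_(x in S) twist_mx x y = 1.
Proof.
move=> yS; rewrite -mulr_suml sumrB sum_twist_hits // sumr_const sub_card.
by field; exact: Q_neq0.
Qed.

(** On expanding, only the sum of products of two [twist_hits] depends on the pair; it is
    [q (q + 1) + q * hits y z], and [hits] is [1 + q [y = z]] on [S]. *)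
Lemma twist_mx_orth (y z : P) : y \in S -> z \in S ->
  \sum_(x in S) twist_mx x y * twist_mx x z = (y == z)%:R.
Proof.
move=> yS zS.
have hh : \sum_(x in S) (twist_hits x y)%:R * (twist_hits x z)%:R =
    Q * (Q + 1) + Q * Q * (y == z)%:R + Q.
  transitivity (\sum_i \sum_j (1 + (i == j)%:R * (Q * (c i y == c j z)%:R - 1)) : F).
    under eq_bigr => x _ do rewrite !twist_hitsE mulr_suml.
    rewrite exchange_big; apply: eq_bigr => i _ /=.
    under eq_bigr => x _ do rewrite mulr_sumr.
    by rewrite exchange_big; apply: eq_bigr => j _ /=; exact: twist_line2.
  transitivity (\sum_(i < q.+1) (Q + Q * (c i y == c i z)%:R)).
    apply: eq_bigr => i _; rewrite big_split /= sumr_const card_ord sum_delta_l.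
    by rewrite -natr1 /Q; ring.
  rewrite big_split /= sumr_const card_ord -mulr_sumr -[_ *+ q.+1]mulr_natr -natr1.
  have -> : \sum_(i < q.+1) (c i y == c i z)%:R = hits F c y z by [].
  by rewrite (hitsE _ oac) sub_coll //= /Q; ring.
have e1 := sum_twist_hits yS; have e2 := sum_twist_hits zS.
transitivity ((\sum_(x in S) (twist_hits x y)%:R * (twist_hits x z)%:R
    - \sum_(x in S) (twist_hits x y)%:R - \sum_(x in S) (twist_hits x z)%:R
    + \sum_(x in S) 1) / (Q * Q)).
  rewrite -!sumrB -big_split mulr_suml; apply: eq_bigr => x _ /=.
  by rewrite /twist_mx; field; exact: Q_neq0.
by rewrite hh e1 e2 sumr_const sub_card; field; exact: Q_neq0.
Qed.


Definition tls_ext (u : P * 'I_2) (y : P) : F :=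
  if twisted u then (if y \in S then twist_mx u.1 y else 0) else (u.1 == y)%:R.

Lemma sum_I2 (f : P * 'I_2 -> F) :
  \sum_u f u = \sum_x (f (x, ord0) + f (x, ord_max)).
Proof.
transitivity (\sum_x \sum_a f (x, a)).
  by rewrite pair_bigA; apply: eq_bigr => -[].
by apply: eq_bigr => x _; rewrite big_ord_recl big_ord1; congr (_ + f (_, _)); apply: val_inj.
Qed.

Lemma sum_in_if (f : P -> F) :
  \sum_y (if y \in S then f y else 0) = \sum_(y in S) f y.
Proof. by rewrite [RHS]big_mkcond. Qed.

Lemma tls_ext0 (x y : P) : tls_ext (x, ord0) y = (x == y)%:R.
Proof. by rewrite /tls_ext /twisted andbF. Qed.

Lemma tls_ext1 (x y : P) : tls_ext (x, ord_max) y =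
  if x \in S then (if y \in S then twist_mx x y else 0) else (x == y)%:R.
Proof. by rewrite /tls_ext /twisted /= andbT. Qed.

Lemma tls_ext_orth (y z : P) :
  \sum_u tls_ext u y * tls_ext u z = 2 * (y == z)%:R.
Proof.
have delta (A : pred P) : y \in A -> \sum_(x in A) (x == y)%:R * (x == z)%:R = (y == z)%:R :> F.
  move=> yA; rewrite (bigD1 y) //= eqxx mul1r big1 ?addr0 // => x /andP[_ /negbTE->].
  by rewrite mul0r.
rewrite sum_I2 big_split /= -[2]/(1 + 1) mulrDl mul1r; congr (_ + _).
  by under eq_bigr do rewrite !tls_ext0; exact: (delta predT).
under eq_bigr do rewrite !tls_ext1.
rewrite (bigID (mem S)) /=.
rewrite [X in X + _](_ : _ = \sum_(x in S) (if y \in S then twist_mx x y else 0)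
    * (if z \in S then twist_mx x z else 0)); last by apply: eq_bigr => x ->.
rewrite [X in _ + X](_ : _ = \sum_(x | x \notin S) (x == y)%:R * (x == z)%:R);
  last by apply: eq_bigr => x /negbTE->.
have [yS|yS] := boolP (y \in S).
  rewrite [X in _ + X]big1 ?addr0 => [|x xS]; last first.
    by case: eqP xS => [->|]; rewrite ?yS ?mul0r.
  have [zS|zS] := boolP (z \in S); first exact: twist_mx_orth.
  rewrite big1 => [|x _]; last by rewrite mulr0.
  by case: eqP yS zS => // ->->.
rewrite [X in X + _]big1 ?add0r => [|x xS]; last by rewrite mul0r.
exact: (delta [pred x | x \notin S]).
Qed.

Lemma tls_ext_row_sum (u : P * 'I_2) : \sum_y tls_ext u y = 1.
Proof.
rewrite /tls_ext; have [/andP[uS _]|_] := boolP (twisted u).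
  by rewrite sum_in_if twist_mx_row_sum.
exact: sum_delta.
Qed.

Lemma tls_ext_col_sum (y : P) : \sum_u tls_ext u y = 2.
Proof.
rewrite sum_I2 big_split /=; congr (_ + _).
  under eq_bigr do rewrite tls_ext0 eq_sym.
  exact: sum_delta.
under eq_bigr do rewrite tls_ext1.
rewrite (bigID (mem S)) /=.
rewrite [X in X + _](_ : _ = \sum_(x in S) (if y \in S then twist_mx x y else 0));
  last by apply: eq_bigr => x ->.
rewrite [X in _ + X](_ : _ = \sum_(x | x \notin S) (x == y)%:R);
  last by apply: eq_bigr => x /negbTE->.
have [yS|yS] := boolP (y \in S).
  rewrite twist_mx_col_sum // big1 ?addr0 // => x xS.
  by case: eqP xS => [->|//]; rewrite yS.
rewrite big1_eq add0r (bigD1 y) //= eqxx big1 ?addr0 // => x /andP[_ /negbTE->].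
by [].
Qed.

Lemma outside_hits (x y : P) (f : 'I_q.+1 -> P) : y \notin S ->
    (forall i, f i \in S) ->
  \sum_i (c i (f i) == c i y)%:R = [exists i, c i (f i) == c i y]%:R :> F.
Proof.
move=> yS fS; case: existsP => [[i ei]|none]; last first.
  by rewrite big1 // => i _; case: eqP => // /eqP ei; case: none; exists i.
rewrite (bigD1 i) //= ei big1 ?addr0 // => j neqj.
case: eqP => // ej; case/eqP: neqj.
exact: (outside_hit_uniq (fS j) (fS i) yS ej (eqP ei)).
Qed.

Lemma coll_outside (x y : P) : x \in S -> y \notin S ->
  (coll c x y)%:R = \sum_i (c i x == c i y)%:R :> F.
Proof.
move=> xS yS; have := hitsE F oac x y; rewrite /hits => ->.
by case: eqP xS yS => [->->//|]; rewrite mulr0 addr0.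
Qed.

(** From [y] outside [S], collinearity is a sum of line indicators, each permuted by
    [twist_mx_line]; at most one of the permuted lines passes through [y], so the sum stays 0 or
    1. *)
Lemma twisted_coll (x y : P) : x \in S -> y \notin S ->
  \sum_(z in S) twist_mx x z * (coll c z y)%:R =
  [exists i, sg i (c i x) == c i y]%:R.
Proof.
move=> xS yS.
have /choice[f fP] : forall i, exists r, r \in S /\ sg i (c i x) = c i r.
  by move=> i; have [r] := sg_into i xS; exists r.
under eq_bigr => z zS do rewrite coll_outside // mulr_sumr.
rewrite exchange_big /=.
under eq_bigr => i _ do rewrite twist_mx_line // (fP i).2.
rewrite outside_hits // => [|i]; last exact: (fP i).1.
by congr _%:R; congr nat_of_bool; apply: eq_existsb => i; rewrite (fP i).2.
Qed.

Lemma tls_ext_coll (u : P * 'I_2) (y : P) :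
  \sum_x tls_ext u x * (coll c x y)%:R =
  ((u.1 \in S) && (y \in S) || [exists i, label i u == c i y])%:R.
Proof.
rewrite /tls_ext /label; case Du: (twisted u); last first.
  rewrite sum_delta_l -/(coll c u.1 y); congr _%:R; congr nat_of_bool.
  by case: andP => // -[uS yS]; exact: sub_coll.
have /andP[uS _] := Du; rewrite uS /=.
transitivity (\sum_(x in S) twist_mx u.1 x * (coll c x y)%:R).
  rewrite -sum_in_if; apply: eq_bigr => x _.
  by case: ifP; rewrite ?mul0r.
have [yS|yS] := boolP (y \in S); last exact: twisted_coll.
rewrite -[RHS](twist_mx_row_sum uS); apply: eq_bigr => x xS.
by rewrite sub_coll // mulr1.
Qed.

(** Over [S] collinearity is constantly 1, which row sums 1 preserve; between a twisted vertex and
    one outside [S], [twisted_coll] applies. *)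
Lemma ext_mx_tls (u v : P * 'I_2) : ext_mx c tls_ext u v = (tls_rel u v)%:R.
Proof.
rewrite /ext_mx; under eq_bigr do rewrite tls_ext_coll.
rewrite /tls_ext /tls_rel /label; case Dv: (twisted v); last first.
  by under eq_bigr do rewrite eq_sym; rewrite sum_delta_r.
have /andP[vS _] := Dv; rewrite vS andbT.
transitivity (\sum_(y in S) twist_mx v.1 y *
    ((u.1 \in S) && (y \in S) || [exists i, label i u == c i y])%:R).
  rewrite -sum_in_if; apply: eq_bigr => y _.
  by case: ifP; rewrite ?mulr0 // => _; exact: mulrC.
have [uS|uS] := boolP (u.1 \in S).
  by rewrite -[RHS](twist_mx_row_sum vS); apply: eq_bigr => y ->; rewrite mulr1.
have labu i : label i u = c i u.1 by rewrite /label /twisted (negbTE uS).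
transitivity (\sum_(y in S) twist_mx v.1 y * (coll c y u.1)%:R).
  apply: eq_bigr => y _; congr (_ * _%:R); congr nat_of_bool.
  by apply: eq_existsb => i; rewrite labu eq_sym.
rewrite twisted_coll //; congr _%:R; congr nat_of_bool.
by apply: eq_existsb => i; rewrite eq_sym -/(label i u) labu.
Qed.

Lemma sum_coll (x : P) :
  \sum_y (coll c x y)%:R = (Q + 1) * (#|G|%:R - 1) + 1 :> F.
Proof.
have : \sum_y hits F c x y = (Q + 1) * #|G|%:R.
  rewrite exchange_big /=.
  transitivity (\sum_(i < q.+1) #|G|%:R : F); last first.
    by rewrite sumr_const card_ord -[_ *+ q.+1]mulr_natl -natr1.
  apply: eq_bigr => i _; rewrite -(sum_line F q_gt0 oac i (c i x)).
  by apply: eq_bigr => y _; rewrite eq_sym.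
under eq_bigr do rewrite (hitsE _ oac).
rewrite big_split /= -mulr_sumr sum_delta => e.
by rewrite -[LHS](addrK (q%:R * 1)) e /Q; ring.
Qed.

Lemma tls_regular (u : tls) :
  #|nbhd u|%:R = 2 * ((Q + 1) * (#|G|%:R - 1) + 1) - 1 :> F.
Proof.
have : \sum_v (tls_rel u v)%:R = 2 * ((Q + 1) * (#|G|%:R - 1) + 1) :> F.
  under eq_bigr do rewrite -ext_mx_tls.
  rewrite exchange_big /=; under eq_bigr do rewrite -mulr_sumr tls_ext_col_sum.
  rewrite -mulr_suml exchange_big /=.
  under eq_bigr do rewrite -mulr_sumr sum_coll.
  by rewrite -mulr_suml tls_ext_row_sum mul1r mulrC.
move=> <-; rewrite (bigD1 u) //= tls_rel_refl [X in X - 1]addrC addrK.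
rewrite -sum1_card natr_sum big_mkcond [RHS]big_mkcond /=; apply: eq_bigr => v _.
by rewrite inE /= /tls_adj eq_sym; case: (v != u) => //=; case: tls_rel.
Qed.

Lemma tls_common (u v : tls) :
  (common_nbrs u v)%:R + 2 * (adj u v)%:R + (u == v)%:R =
  2 * (#|G|%:R - 2 * Q) * ((u == v) || adj u v)%:R
    + 2 * Q * (#|G|%:R - Q) * (\sum_y tls_ext u y * tls_ext v y)
    + 2 * Q * (Q + 1) :> F.
Proof.
have := ext_mx_sq q_gt0 oac tls_ext_orth tls_ext_row_sum u v.
rewrite ext_mx_tls tls_relE => <-.
rewrite -common_nbrs_reflexive; apply: eq_bigr => w _.
by rewrite !ext_mx_tls !tls_relE.
Qed.

(** The two rows of E have disjoint supports. For non-adjacent vertices E E^T thus drops out of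
    [tls_common], leaving mu. *)
Lemma tls_ext_dot_nonadj (u v : P * 'I_2) : ~~ tls_rel u v ->
  \sum_y tls_ext u y * tls_ext v y = 0.
Proof.
rewrite /tls_rel negb_or => /andP[nS nrel]; apply: big1 => y _.
rewrite /tls_ext; case Du: (twisted u); case Dv: (twisted v).
- by move: nS; case/andP: Du => ->; case/andP: Dv => ->.
- case: (eqVneq v.1 y) => [<-|_]; last by rewrite mulr0.
  by case/andP: Du nS => -> _ /= /negbTE->; rewrite mul0r.
- case: (eqVneq u.1 y) => [<-|_]; last by rewrite mul0r.
  by case/andP: Dv nS => -> _; rewrite andbT => /negbTE->; rewrite mulr0.
case: (eqVneq u.1 y) => [uy|_]; last by rewrite mul0r.
case: (eqVneq v.1 y) => [vy|_]; last by rewrite mulr0.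
case/existsP: nrel; exists ord0.
by rewrite /label Du Dv uy vy.
Qed.

Lemma tls_ext_dot_twist (x y : P) : x \in S -> y \in S ->
  \sum_z tls_ext (x, ord_max) z * tls_ext (y, ord0) z = twist_mx x y.
Proof.
move=> xS yS; under eq_bigr do rewrite tls_ext0 tls_ext1 xS eq_sym.
by rewrite sum_delta_r yS.
Qed.

Lemma tls_ext_dot_plain (x y : P) (a b : 'I_2) :
    ~~ twisted (x, a) -> ~~ twisted (y, b) ->
  \sum_z tls_ext (x, a) z * tls_ext (y, b) z = (x == y)%:R.
Proof.
move=> /negbTE nx /negbTE ny; rewrite /tls_ext nx ny /=.
by rewrite sum_delta_l eq_sym.
Qed.

Lemma tls_mx : adjmx F tls = fmx (ext_mx c tls_ext) + (- 1)%:M.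
Proof.
rewrite adjmx_fmx scalar_fmx add_fmx; apply: eq_fmx => u v.
rewrite ext_mx_tls -tls_relE; case: eqVneq => [->|_] /=.
  by rewrite tls_adj_irr mulr1 subrr.
by rewrite mulr0 addr0.
Qed.

End Twist.

(** * Choice of the permutations *)

Section ChoiceOfTwist.
Local Open Scope nat_scope.

Definition rotate_first (i j : nat) : nat :=
  if j < i then (if j.+1 < i then j.+1 else 0) else j.

Definition unrotate_first (i j : nat) : nat :=
  if j < i then (if j == 0 then i.-1 else j.-1) else j.

Lemma unrotate_firstK (i j : nat) : rotate_first i (unrotate_first i j) = j.
Proof.
rewrite /unrotate_first; case: (ltnP j i) => ji; last by rewrite /rotate_first ltnNge ji.
case: eqP => j0; rewrite /rotate_first; case: ifP => //; try case: ifP; lia.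
Qed.

Lemma rotate_firstK (i j : nat) : unrotate_first i (rotate_first i j) = j.
Proof.
rewrite /rotate_first; case: (ltnP j i) => ji; last by rewrite /unrotate_first ltnNge ji.
case: ifP => j1; rewrite /unrotate_first; case: ifP => //=; lia.
Qed.

Lemma rotate_first_lt (q i j : nat) : i <= q -> j < q -> rotate_first i j < q.
Proof. rewrite /rotate_first; do !case: ifP; lia. Qed.

Lemma unrotate_first_lt (q i j : nat) : i <= q -> j < q -> unrotate_first i j < q.
Proof. rewrite /unrotate_first; do !case: ifP; lia. Qed.

Lemma card_ord_le (n m : nat) : m < n -> #|[set i : 'I_n | i <= m]| = m.+1.
Proof.
move=> lt_mn; rewrite -sum1_card.
rewrite (eq_bigl (fun i : 'I_n => i < m.+1)); last by move=> i; rewrite inE.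
by rewrite -(big_ord_widen n (fun=> 1)) // sum_nat_const card_ord muln1.
Qed.

Variables (q : nat) (P G : finType) (c : 'I_q.+1 -> P -> G) (S : {set P}).
Hypotheses (q_gt1 : 1 < q) (oac : oa c) (subS : oa_sub q c S).

(* On the class-0 line [pt 0, ..., pt (q - 1)] of [S], whose points label the
   lines of every other class, [sg i] rotates the first [i] labels; so [pt j] is
   fixed by exactly the classes [i <= j]. *)
Lemma twist_exists : exists sg : 'I_q.+1 -> G -> G,
  [/\ forall i s, s \in S -> exists2 r, r \in S & sg i (c i s) = c i r,
      forall i s, s \in S -> exists2 r, r \in S & sg i (c i r) = c i s,
      forall i r s, r \in S -> s \in S -> sg i (c i r) = sg i (c i s) ->
        c i r = c i s &
      forall m, m <= q -> m != 1 -> exists x y,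
        [/\ x \in S, y \in S & twist_hits c sg x y = m]].
Proof.
have [[s0 s0S] ex_meet size_line] := subS.
pose A := [set r in S | c ord0 r == c ord0 s0]; pose l := enum A.
have size_l : size l = q by rewrite -cardE size_line.
pose pt j := nth s0 l j.
have ptA j : j < q -> pt j \in A by move=> ltj; rewrite -mem_enum mem_nth ?size_l.
have ptS j : j < q -> pt j \in S by move=> /ptA; rewrite inE => /andP[].
have pt0 j : j < q -> c ord0 (pt j) = c ord0 s0.
  by move=> /ptA; rewrite inE => /andP[_ /eqP].
have pt_inj j k : j < q -> k < q -> pt j = pt k -> j = k.
  by move=> ltj ltk /eqP; rewrite nth_uniq ?size_l ?enum_uniq // => /eqP.
have pt_cinj (i : 'I_q.+1) j k : i != ord0 -> j < q -> k < q ->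
    c i (pt j) = c i (pt k) -> j = k.
  move=> i0 ltj ltk e; apply: pt_inj => //; apply: (oac.2 i ord0) => //.
  by rewrite !pt0.
have cover (i : 'I_q.+1) s : i != ord0 -> s \in S ->
    exists2 j, j < q & c i s = c i (pt j).
  move=> i0 sS; have i0' : ord0 != i by rewrite eq_sym.
  have [r rS [r0 ri]] := ex_meet ord0 i s0 s i0' s0S sS.
  have rA : r \in l by rewrite mem_enum inE rS r0 eqxx.
  by exists (index r l); [rewrite -size_l index_mem | rewrite /pt nth_index].
(* A label outside the list has index [q], which the rotation fixes, and the default of [nth]
   returns the label itself. *)
pose sg (i : 'I_q.+1) (a : G) :=
  if i == ord0 then a else
  let s := [seq c i r | r <- l] in nth a s (rotate_first i (index a s)).
have sg0 a : sg ord0 a = a by rewrite /sg eqxx.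
have lei (i : 'I_q.+1) : i <= q by rewrite -ltnS.
have sg_pt (i : 'I_q.+1) j : i != ord0 -> j < q ->
    sg i (c i (pt j)) = c i (pt (rotate_first i j)).
  move=> i0 ltj; rewrite /sg (negbTE i0).
  have -> : index (c i (pt j)) [seq c i r | r <- l] = j.
    rewrite -(nth_map s0 (c i s0)) ?size_l // index_uniq ?size_map ?size_l //.
    apply/(uniqP (c i s0)) => a b; rewrite !inE size_map size_l => lta ltb.
    by rewrite !(nth_map s0) ?size_l //; exact: pt_cinj.
  by rewrite (nth_map s0) // size_l rotate_first_lt.
exists sg; split.
- move=> i s sS; have [->|i0] := eqVneq i ord0; first by exists s.
  have [j ltj ->] := cover i s i0 sS; rewrite sg_pt //.
  by exists (pt (rotate_first i j)); rewrite // ptS // rotate_first_lt.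
- move=> i s sS; have [->|i0] := eqVneq i ord0; first by exists s.
  have [j ltj ->] := cover i s i0 sS.
  exists (pt (unrotate_first i j)); first by rewrite ptS // unrotate_first_lt.
  by rewrite sg_pt ?unrotate_first_lt // unrotate_firstK.
- move=> i r s rS sS; have [->|i0] := eqVneq i ord0; first by rewrite !sg0.
  have [j ltj ->] := cover i r i0 rS; have [k ltk ->] := cover i s i0 sS.
  rewrite !sg_pt // => /pt_cinj; rewrite !rotate_first_lt // => /(_ i0 isT isT).
  by move/(congr1 (unrotate_first i)); rewrite !rotate_firstK => ->.
move=> m le_mq m1; have q_gt0 := ltnW q_gt1.
(* For [m = 0], pair [pt 0] with another point [y] of the class-1 line through [pt 1]. Class 1
   rotates nothing, so a hit there would put [pt 0] on that line; classes [i >= 2] move [pt 0] to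
   [pt 1], so a hit there, or in class 0, would give [y] a second line through [pt 1]. *)
have [m0|m_gt0] := posnP m.
  have /card_gt1P[y1 [y2 [y1A y2A y12]]] :
      1 < #|[set r in S | c (inord 1) r == c (inord 1) (pt 1)]|.
    by rewrite size_line ?ptS.
  have [y yA ny] : exists2 y, y \in [set r in S | c (inord 1) r == c (inord 1) (pt 1)]
      & y != pt 1.
    have [e|ne] := eqVneq y1 (pt 1); last by exists y1.
    by exists y2; rewrite // -e eq_sym.
  move: yA; rewrite inE => /andP[yS /eqP y1E].
  have v1 : (inord 1 : 'I_q.+1) = 1 :> nat by rewrite inordK.
  have i01 : inord 1 != ord0 :> 'I_q.+1 by rewrite -val_eqE /= v1.
  exists (pt 0), y; split; rewrite ?ptS // m0.
  apply/eqP; rewrite cards_eq0; apply/eqP/setP => i; rewrite !inE.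
  apply/negP => /eqP; have [->|i0] := eqVneq i ord0.
    rewrite sg0 pt0 // => e0; case/eqP: ny; apply: (oac.2 (inord 1) ord0) => //.
    by rewrite -e0 pt0.
  rewrite sg_pt //; have [->|i1] := eqVneq i (inord 1).
    rewrite /rotate_first v1 /= y1E => /pt_cinj E.
    by have := E i01 q_gt0 q_gt1.
  have i2 : 1 < i.
    by move: i0 i1; rewrite -!val_eqE /= v1; lia.
  rewrite /rotate_first (ltnW i2) i2 => e1; case/eqP: ny.
  by apply: (oac.2 i (inord 1)).
(* [pt m.-1] is fixed by the [m] classes [i < m]. The value 1 is exceptional: rotating a single
   label is the identity, so [pt 0] is fixed by class 1 as well. *)
have ltm : m.-1 < q by rewrite (ltn_predK m_gt0).
exists (pt m.-1), (pt m.-1); split; rewrite ?ptS //.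
rewrite -[RHS](ltn_predK m_gt0) -(card_ord_le (n := q.+1)); last by exact: ltnW.
apply: eq_card => i; rewrite !inE; have [->|i0] := eqVneq i ord0; first by rewrite sg0 eqxx.
rewrite sg_pt //; apply/eqP/idP.
  move=> /pt_cinj; rewrite rotate_first_lt // => /(_ i0 isT ltm).
  by rewrite /rotate_first; do !case: ifP; lia.
by move=> le_i; rewrite /rotate_first ltnNge le_i.
Qed.

End ChoiceOfTwist.

(** * Distance two and co-edge-regularity *)

Section DistanceTwo.
Variable G : sgraph.

Lemma has_dist2_nonadj (x y : G) : has_dist x y 2 -> x != y /\ ~~ adj x y.
Proof.
case=> _ short; split; apply/negP.
  by move=> /eqP e; have := short [::] isT e.
by move=> xy; have := short [:: y]; rewrite /= xy => /(_ isT erefl).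
Qed.

Lemma nonadj_has_dist2 (x y : G) : x != y -> ~~ adj x y ->
  (0 < common_nbrs x y)%N -> has_dist x y 2.
Proof.
move=> neq nadj /card_gt0P[z]; rewrite !inE => /andP[xz yz]; split.
  by exists [:: z; y]; rewrite /= xz adj_sym yz.
move=> [|a [|b p]] //=; first by move=> _ e; rewrite e eqxx in neq.
by rewrite andbT => xa e; rewrite -e xa in nadj.
Qed.

Lemma coedge_regular_of_common (k mu : nat) (x0 y0 : G) : (0 < mu)%N ->
    regular_graph G k ->
    (forall x y : G, x != y -> ~~ adj x y -> common_nbrs x y = mu) ->
    x0 != y0 -> ~~ adj x0 y0 ->
  coedge_regular G #|G| k mu.
Proof.
move=> mu_gt0 reg com neq0 nadj0; split.
  by split=> // x y /has_dist2_nonadj[]; exact: com.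
have dist2 (x y : G) : x != y -> ~~ adj x y -> has_dist x y 2.
  by move=> neq nadj; apply: nonadj_has_dist2; rewrite ?com.
split; last by exists x0, y0; exact: dist2.
move=> x y; have [<-|neq] := eqVneq x y.
  by exists 0%N => //; split; [exists [::] | ].
have [xy|nadj] := boolP (adj x y); last by exists 2%N => //; exact: dist2.
exists 1%N => //; split; first by exists [:: y]; rewrite /= xy.
by move=> [|a p] //= _ e; rewrite e eqxx in neq.
Qed.

Lemma regular_has_nonadj (k : nat) (x : G) : regular_graph G k ->
  (k.+1 < #|G|)%N -> exists y : G, x != y /\ ~~ adj x y.
Proof.
move=> reg ltk; have : (0 < #|~: (x |: nbhd x)|)%N.
  rewrite cardsCs setCK cardsU1 reg inE adj_irr add1n subn_gt0.
  exact: ltk.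
by case/card_gt0P=> y; rewrite !inE negb_or eq_sym => /andP[]; exists y.
Qed.

End DistanceTwo.

Lemma undup_blocks (T : eqType) (a b c d : T) (k l m : nat) :
    (0 < k)%N -> (0 < l)%N -> (0 < m)%N -> uniq [:: a; b; c; d] ->
  size (undup (a :: nseq k b ++ nseq l c ++ nseq m d)) = 4%N.
Proof.
move=> k0 l0 m0 u; rewrite -[RHS](_ : size [:: a; b; c; d] = 4%N) //.
apply: perm_size; apply: uniq_perm => //; first exact: undup_uniq.
move=> x; rewrite mem_undup !inE !mem_cat !mem_nseq k0 l0 m0.
by rewrite !andTb.
Qed.

Section TargetSpectrum.
Variables (F : numFieldType) (q n : nat).

Definition tls_spec : seq F := 2 * (q%:R + 1) * (n%:R - 1) + 1
  :: nseq ((n - 1) * (q + 1)) (2 * n%:R - 2 * q%:R - 1)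
  ++ nseq ((n - 1) * (n - q)) (- 2 * q%:R - 1)
  ++ nseq (n ^ 2) (- 1).

Hypotheses (q_gt1 : (1 < q)%N) (big_order : (q + 2 <= n)%N).

Let q_gt0 : (0 < q)%N := ltnW q_gt1.
Let N : F := n%:R.
Let Q : F := q%:R.

Let N_sub (m : nat) : (m <= n)%N -> (n - m)%:R = N - m%:R.
Proof. by move=> le_mn; rewrite natrB. Qed.

Let eqNq : exists d : nat, n = (q + 2 + d)%N.
Proof. by exists (n - (q + 2))%N; rewrite subnKC. Qed.

Lemma spec_undup : size (undup tls_spec) = 4%N.
Proof.
have [d En] := eqNq; have EN : N = Q + 2 + d%:R by rewrite /N En !natrD.
have neq (m : nat) (a b : F) : (0 < m)%N -> a - b = m%:R -> a != b.
  by move=> m0 e; rewrite -subr_eq0 e pnatr_eq0 -lt0n.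
apply: undup_blocks.
- by rewrite muln_gt0 subn_gt0; apply/andP; split; lia.
- by rewrite muln_gt0 !subn_gt0; apply/andP; split; lia.
- by rewrite expn_gt0; lia.
rewrite /= !inE !negb_or !andbT -!andbA; apply/and5P; split; last (apply/andP; split).
- apply: (neq (2 * q * n)%N); first by rewrite !muln_gt0; lia.
  by rewrite !natrM -/N -/Q; ring.
- apply: (neq (2 * (q + 1) * (n - 1) + 2 * q + 2)%N); first by rewrite addn2.
  by rewrite !natrD !natrM !natrD N_sub -/Q; [ring|lia].
- apply: (neq (2 * (q + 1) * (n - 1) + 2)%N); first by rewrite addn2.
  by rewrite !natrD !natrM !natrD N_sub -/Q; [ring|lia].
- apply: (neq (2 * n)%N); first by rewrite muln_gt0; lia.
  by rewrite natrM -/N; ring.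
- apply: (neq (2 * (n - q))%N); first by rewrite muln_gt0; lia.
  by rewrite natrM N_sub -/Q; [ring|lia].
rewrite eq_sym; apply: (neq (2 * q)%N); first by rewrite muln_gt0.
by rewrite natrM -/Q; ring.
Qed.

(** The order of [F] may be partial; entries are compared through differences that are natural
    numbers. *)
Lemma spec_min : - 2 * Q - 1 \in tls_spec /\ {in tls_spec, forall a, - 2 * Q - 1 <= a}.
Proof.
split.
  have [d En] := eqNq.
  have pos : (0 < (n - 1) * (n - q))%N.
    by rewrite muln_gt0 !subn_gt0; apply/andP; split; lia.
  by rewrite inE !mem_cat !mem_nseq pos eqxx /= !orbT.
have le (a : F) (m : nat) : a - (- 2 * Q - 1) = m%:R -> - 2 * Q - 1 <= a.
  by move=> e; rewrite -subr_ge0 e ler0n.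
move=> a; rewrite inE !mem_cat !mem_nseq => /or4P[|/andP[_]|/andP[_]|/andP[_]] /eqP->.
- apply: (le _ (2 * (q + 1) * (n - 1) + 2 * q + 2)%N).
  by rewrite !natrD !natrM !natrD N_sub -/Q; [ring|lia].
- by apply: (le _ (2 * n)%N); rewrite natrM -/N; ring.
- by apply: (le _ 0%N); ring.
- by apply: (le _ (2 * q)%N); rewrite natrM -/Q; ring.
Qed.

End TargetSpectrum.

(** * Properties of the twisted graph *)

Section TwistedLatinSquareGraph.
Variables (F : numFieldType) (q : nat) (P G : finType) (c : 'I_q.+1 -> P -> G).
Variables (S : {set P}) (sg : 'I_q.+1 -> G -> G).
Hypotheses (q_gt1 : (1 < q)%N) (oac : oa c) (subS : oa_sub q c S).
Hypothesis sg_into : forall i s, s \in S ->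
  exists2 r, r \in S & sg i (c i s) = c i r.
Hypothesis sg_onto : forall i s, s \in S ->
  exists2 r, r \in S & sg i (c i r) = c i s.
Hypothesis sg_inj : forall i r s, r \in S -> s \in S ->
  sg i (c i r) = sg i (c i s) -> c i r = c i s.
Hypothesis sg_hits : forall m, (m <= q)%N -> m != 1%N -> exists x y,
  [/\ x \in S, y \in S & twist_hits c sg x y = m].
Hypothesis big_order : (q + 2 <= #|G|)%N.

Let q_gt0 : (0 < q)%N := ltnW q_gt1.
Let n := #|G|.
Let X := tls c S sg.
Let N : F := n%:R.
Let Q : F := q%:R.

Let spec := tls_spec F q n.

Let card_ext : (#|{: P * 'I_2}| - #|P| = n ^ 2)%N.
Proof. by rewrite card_prod card_ord (card_oa q_gt0 oac) muln2 -addnn addnK. Qed.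

Let leP_ext : (#|P| <= #|{: P * 'I_2}|)%N.
Proof. by rewrite card_prod card_ord muln2 -addnn leq_addr. Qed.

Let lt_qn : (q < #|G|)%N.
Proof. by apply: leq_trans big_order; rewrite addn2. Qed.

Lemma tls_spectrum : has_spectrum (adjmx F X) spec.
Proof.
rewrite (tls_mx q_gt0 oac subS sg_into) /spec /tls_spec -card_ext.
by apply: net_ext_spectrum => //; apply: tls_ext_orth.
Qed.

(** Same computation as for the twisted graph, with E made of two identity matrices. *)
Lemma clique_ext_spectrum :
  has_spectrum (adjmx F (clique_ext 2 (point_graph (fibers c)))) spec.
Proof.
pose E (u : P * 'I_2) (y : P) : F := (u.1 == y)%:R.
have orth y z : \sum_u E u y * E u z = 2 * (y == z)%:R.
  rewrite sum_I2 big_split /= -[2]/(1 + 1) mulrDl !mul1r.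
  by congr (_ + _); rewrite /E /=; under eq_bigr do rewrite eq_sym; exact: sum_delta_l.
have -> : adjmx F (clique_ext 2 (point_graph (fibers c))) =
    fmx (ext_mx c E) + (- 1)%:M.
  rewrite adjmx_fmx scalar_fmx add_fmx; apply: eq_fmx => u v.
  have -> : ext_mx c E u v = (coll c u.1 v.1)%:R.
    rewrite /ext_mx /E; under eq_bigr do rewrite sum_delta_l eq_sym.
    by rewrite sum_delta_r.
  rewrite -clique_ext_adj_fibers; case: eqVneq => [->|_] /=.
    by rewrite clique_ext_irr mulr1 subrr.
  by rewrite mulr0 addr0.
rewrite /spec /tls_spec -card_ext; exact: net_ext_spectrum.
Qed.

Let N_sub (m : nat) : (m <= n)%N -> (n - m)%:R = N - m%:R.
Proof. by move=> le_mn; rewrite natrB. Qed.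

Let eqNq : exists d : nat, n = (q + 2 + d)%N.
Proof. by exists (n - (q + 2))%N; rewrite subnKC. Qed.

Let k := (2 * (q + 1) * (n - 1) + 1)%N.

Lemma tls_is_regular : regular_graph X k.
Proof.
move=> u; apply/eqP; rewrite -(eqr_nat F).
rewrite (tls_regular q_gt0 oac subS sg_into sg_onto sg_inj F u) -/n -/N.
by rewrite /k !natrD !natrM !natrD N_sub; [apply/eqP; ring|lia].
Qed.

Lemma tls_coedge : coedge_regular X #|X| k (2 * q * (q + 1)) /\
  exists x y : X, x != y /\ ~~ adj x y.
Proof.
have [[s sS] _ _] := subS.
have [|y [ny nadj]] := regular_has_nonadj ((s, ord0) : X) tls_is_regular.
  rewrite /k card_prod card_ord (card_oa q_gt0 oac) -/n.
  by have [d En] := eqNq; rewrite En; nia.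
split; last by exists (s, ord0), y.
apply: (coedge_regular_of_common _ tls_is_regular _ ny nadj).
  by rewrite !muln_gt0 q_gt0 addn1.
move=> u v neq nuv; apply/eqP; rewrite -(eqr_nat F).
have := tls_common q_gt0 oac subS sg_into sg_onto sg_inj F u v.
rewrite (negbTE neq) (negbTE nuv) /= tls_ext_dot_nonadj; last first.
  by rewrite -tls_relE negb_or neq.
by rewrite !mulr0 !add0r !addr0 => ->; rewrite !natrM natrD.
Qed.

Let level m := (2 * (n - q) * m + 2 * q ^ 2 - 2)%N.

Let level_of (u v : X) (m : nat) : u != v -> adj u v ->
    Q * (\sum_y tls_ext c S sg F u y * tls_ext c S sg F v y) = m%:R - 1 ->
  common_nbrs u v = level m.
Proof.
move=> neq uv dot.
have := tls_common q_gt0 oac subS sg_into sg_onto sg_inj F u v.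
rewrite (negbTE neq) uv /= -/n -/N => e.
suff e2 : (common_nbrs u v + 2)%N = (2 * (n - q) * m + 2 * q ^ 2)%N.
  by rewrite /level -e2 addnK.
apply/eqP; rewrite -(eqr_nat F) !natrD !natrM N_sub; last exact: ltnW.
apply/eqP; transitivity (2 * (N - 2 * Q) + 2 * (N - Q) * (m%:R - 1) + 2 * Q * (Q + 1)).
  rewrite -dot; move: e; rewrite /= !mulr1 addr0 => ->.
  by rewrite -/Q; ring.
by rewrite -/Q; ring.
Qed.

Lemma tls_lambda_level : (q + 2 <= lambda_level X)%N.
Proof.
rewrite /lambda_level; set L := undup _.
rewrite -[(q + 2)%N](size_iota 0) -(size_map level); apply: uniq_leq_size.
  rewrite map_inj_in_uniq ?iota_uniq // => a b _ _.
  have : (0 < n - q)%N by rewrite subn_gt0.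
  have : (2 <= 2 * q ^ 2)%N by rewrite leq_pmulr // expn_gt0 q_gt0.
  by rewrite /level; nia.
move=> lv /mapP[m]; rewrite mem_iota add0n /= => ltm ->; rewrite mem_undup.
suff [u [v [neq uv dot]]] : exists u v : X, [/\ u != v, adj u v &
    Q * (\sum_y tls_ext c S sg F u y * tls_ext c S sg F v y) = m%:R - 1].
  apply/mapP; exists (u, v); last by rewrite (level_of neq uv dot).
  by rewrite mem_enum.
have Q0 : Q != 0 by rewrite pnatr_eq0 -lt0n.
have [[s sS] _ size_line] := subS.
have adjS (u v : X) : u != v -> u.1 \in S -> v.1 \in S -> adj u v.
  by move=> neq uS vS; rewrite /= /tls_adj neq /tls_rel uS vS.
have plain (x : P) : ~~ twisted S (x, ord0) by rewrite /twisted andbF.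
(* The value 1, absent from [sg_hits], comes from two untwisted vertices over [S], whose rows of E
   are orthogonal. *)
have [m1|m1] := eqVneq m 1%N.
  have /card_gt1P[r [r' [rA rA' neq]]] : (1 < #|[set r in S | c ord0 r == c ord0 s]|)%N.
    by rewrite size_line.
  move: rA rA'; rewrite !inE => /andP[rS _] /andP[rS' _].
  have neq' : (r, ord0) != (r', ord0) :> X by rewrite xpair_eqE (negbTE neq).
  exists (r, ord0), (r', ord0); split=> //; first exact: adjS.
  by rewrite tls_ext_dot_plain // (negbTE neq) m1 mulr0 subrr.
have [le_m|] := leqP m q.
  have [x' [y' [xS yS hits]]] := sg_hits le_m m1.
  have neq' : (x', ord_max) != (y', ord0) :> X by rewrite xpair_eqE andbF.
  exists (x', ord_max), (y', ord0); split=> //; first exact: adjS.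
  by rewrite tls_ext_dot_twist // /twist_mx hits mulrC divfK.
(* The value [q + 1] comes from the two copies of a point outside [S], whose rows of E coincide. *)
move=> lt_qm; have -> : m = q.+1 by lia.
have [z zS] : exists z, z \notin S.
  apply/existsP; rewrite -negb_forall; apply/negP => /forallP allS.
  have : #|P|%:R = Q * Q :> F.
    rewrite -(sub_card q_gt0 oac subS); congr _%:R; apply: eq_card => z.
    by rewrite allS.
  rewrite (card_oa q_gt0 oac) -natrM => /eqP; rewrite eqr_nat -[(_ ^ 2)%N]/(n * n)%N.
  by have [d ->] := eqNq; nia.
have ntw a : ~~ twisted S (z, a) by rewrite /twisted (negbTE zS).
exists (z, ord0), (z, ord_max); split.
- by rewrite xpair_eqE andbF.
- rewrite /= /tls_adj xpair_eqE andbF /tls_rel; apply/orP; right.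
  apply/existsP; exists ord0; rewrite /label (negbTE (ntw _)) (negbTE (ntw _)).
  exact: eqxx.
by rewrite tls_ext_dot_plain // eqxx mulr1 -natr1 addrK.
Qed.

Lemma tls_coherent_rank : (q + 4 <= coherent_rank F X)%N.
Proof.
have [_ [x [y [neq nadj]]]] := tls_coedge.
apply: leq_trans (coherent_rank_ge F neq nadj).
by rewrite -[4%N]/(2 + 2)%N addnA leq_add2r tls_lambda_level.
Qed.

End TwistedLatinSquareGraph.

Theorem theorem5p3 (R : realType) (q : nat) (q_ge2 : (2 <= q)%N)
    (plane : exists (P : finType) (Ls : {set {set P}}), affine_plane q Ls) :
  exists N : nat, forall n : nat, (N <= n)%N -> exists TLS : sgraph,
    [/\ (* (i) *)
        [/\ exists (P : finType) (Ls : {set {set P}}), net q.+1 n Ls /\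
              cospectral R[i] TLS (clique_ext 2 (point_graph Ls)),
            perm_eq (spectrum (adjmx R[i] TLS))
              (nseq 1 (2 * (q%:R + 1) * (n%:R - 1) + 1)
               ++ nseq ((n - 1) * (q + 1)) (2 * n%:R - 2 * q%:R - 1)
               ++ nseq ((n - 1) * (n - q)) (- 2 * q%:R - 1)
               ++ nseq (n ^ 2) (- 1)),
            size (undup (spectrum (adjmx R[i] TLS))) = 4%N &
            - 2 * q%:R - 1 \in spectrum (adjmx R[i] TLS) /\
            {in spectrum (adjmx R[i] TLS),
              forall a : R[i], - 2 * q%:R - 1 <= a}],
        (* (ii) *)
        exists v k : nat, coedge_regular TLS v k (2 * q * (q + 1))%N &
        (* (iii) *)
        (q + 2 <= lambda_level TLS)%N /\
        (q + 4 <= coherent_rank R[i] TLS)%N].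
Proof.
have [P0 [Ls plane']] := plane.
have [N0 HN] := oa_large_sub q_ge2 plane'.
(* [q + 2 <= n] keeps all multiplicities positive and leaves room for non-adjacent vertices and for
   points outside [S]. *)
exists (maxn N0 (q + 2)) => n; rewrite geq_max => /andP[/HN[P [G [c [S [cG oac subS]]]]]].
rewrite -cG => big_order; have [sg [into onto inj hits]] := twist_exists q_ge2 oac subS.
have spT := has_spectrum_adjmx (tls_spectrum R[i] q_ge2 oac subS into onto inj big_order).
have spC := has_spectrum_adjmx (clique_ext_spectrum R[i] q_ge2 oac big_order).
exists (tls c S sg); split.
- split.
  + exists P, (fibers c); split.
      apply: net_of_oa => //; [exact: ltnW | apply: leq_trans big_order; exact: leq_addl].
    by rewrite /cospectral (perm_trans spT) // perm_sym.
  + exact: spT.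
  + rewrite (perm_size (perm_undup (perm_mem spT))); exact: spec_undup.
  + have [min_in min_le] := spec_min R[i] q_ge2 big_order; split.
      by rewrite (perm_mem spT).
    by move=> a; rewrite (perm_mem spT); exact: min_le.
- have [coe _] := tls_coedge R[i] q_ge2 oac subS into onto inj big_order.
  by do 2 eexists; exact: coe.
split; first exact: (tls_lambda_level R[i]).
exact: tls_coherent_rank.
Qed.
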